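(* Let $\Pi$ be a mini-gringo program and let $I$ be a finite set of precomputed atoms. Then $I$ is a stable model of $\Pi$ if and only if there exists an interpretation $J$ of the signature $\sigma_0^{<}$ whose reduct to $\sigma_0$ (obtained by forgetting the interpretations of the predicates $<_{pq}$) equals $I^{\sigma_0}$ and such that $J$ is a model of $\mathrm{OC}(\Pi)$.
   Context: Mini-gringo syntax. Fix countably infinite sets of numerals, symbolic constants and program variables, and a bijection $n\mapsto\overline{n}$ from integers to numerals. Program terms: numerals, symbolic constants, program variables, $\mathit{inf}$, $\mathit{sup}$; $|t|$; $(t_1\circ t_2)$ for $\circ\in\{+,-,\times,/,\backslash,..\}$. Ground = variable-free; precomputed = ground without operation symbols. Precomputed terms are totally ordered with $\mathit{inf}$ least, $\mathit{sup}$ greatest, $\overline m<\overline n$ iff $m<n$. An atom is $p(\mathbf t)$ ($p$ a symbolic constant); a literal is an atom preceded by zero, one or two $\mathit{not}$; a comparison is $t_1\prec t_2$, $\prec\in\{=,\neq,<,>,\le,\ge\}$. A rule is $\mathit{Head}\leftarrow\mathit{Body}$ with $\mathit{Body}$ a possibly empty conjunction of literals and comparisons and $\mathit{Head}$ an atom $p(\mathbf t)$ (basic rule), $\{p(\mathbf t)\}$ (choice rule) or empty (constraint). A program is a finite set of rules, each predicate having a single arity; $\mathcal L(\Pi)$ is its set of predicates. For a rule $R$, $\mathrm{Body}(R)$ is its body, $B^+(R)$ the set of un-negated atoms in its body, $\mathrm{HeadLit}(R)=p(\mathbf t)$ if the head is $p(\mathbf t)$ or $\{p(\mathbf t)\}$.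 An instance of a rule replaces all variables by precomputed terms. Values and $\tau$. For ground $t$, $\mathrm{vals}(t)$ is: $\{t\}$ for numerals, symbolic constants, $\mathit{inf}$, $\mathit{sup}$; for $|t_1|$ the numerals $\overline{|n|}$, $\overline n\in\mathrm{vals}(t_1)$; for $t_1\circ t_2$ ($\circ\in\{+,-,\times\}$) the $\overline{n_1\circ n_2}$ with $\overline{n_i}\in\mathrm{vals}(t_i)$; for $t_1/t_2$ the $\overline{\mathrm{rd}(n_1/n_2)}$ and for $t_1\backslash t_2$ the $\overline{n_1-n_2\mathrm{rd}(n_1/n_2)}$ ($n_2\neq0$), where $\mathrm{rd}$ rounds toward zero; for $t_1..t_2$ the $\overline m$ with $n_1\le m\le n_2$; tuples componentwise. $\tau(p(\mathbf t))=\bigvee_{\mathbf r\in\mathrm{vals}(\mathbf t)}p(\mathbf r)$, $\tau(\mathit{not}\,p(\mathbf t))=\bigvee\neg p(\mathbf r)$, $\tau(\mathit{not}\,\mathit{not}\,p(\mathbf t))=\bigvee\neg\neg p(\mathbf r)$; $\tau(t_1\prec t_2)=\top$ if $r_1\prec r_2$ for some $r_i\in\mathrm{vals}(t_i)$, else $\bot$; conjunctions componentwise. Ground basic rule: $\tau(\mathit{Body})\to\bigwedge_{\mathbf r}p(\mathbf r)$; choice rule: $\tau(\mathit{Body})\to\bigwedge_{\mathbf r}(p(\mathbf r)\vee\neg p(\mathbf r))$; constraint: $\neg\tau(\mathit{Body})$. $\tau(\Pi)=\{\tau(R):R$ an instance of a rule of $\Pi\}$. With $\neg F:=F\to\bot$,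 the reduct $F^I$ of a propositional formula w.r.t. a set $I$ of precomputed atoms is $\bot$ if $I\not\models F$, $p$ if $F$ is an atom $p\in I$, and $G^I\otimes H^I$ if $F=G\otimes H$ ($\otimes\in\{\wedge,\vee,\to\}$) and $I\models F$. $I$ is a stable model of $\Pi$ iff $I$ is the $\subseteq$-minimal model of $\{F^I:F\in\tau(\Pi)\}$. Two-sorted logic. Signature $\sigma_0$: sort general with subsort integer; all precomputed terms as object constants (numerals of sort integer); $|\cdot|$, $+,-,\times$ as integer functions; each program predicate $p/n$ with general arguments; comparisons $=,\neq,\le,\ge,<,>$ on general. Program variables range over general, integer variables over integer. A standard interpretation has general domain the precomputed terms, integer domain the numerals, every object constant denoting itself, arithmetic as usual and comparisons according to the total order. For a set $I$ of precomputed atoms, $I^{\sigma_0}$ is the standard interpretation in which a precomputed atom is true iff it is in $I$. Formula $\mathrm{val}_t(V)$ ($V$ a variable): $V=t$ if $t$ precomputed or a variable; $\exists I(\mathrm{val}_{t_1}(I)\wedge V=|I|)$ for $|t_1|$; $\exists I,J(\mathrm{val}_{t_1}(I)\wedge\mathrm{val}_{t_2}(J)\wedge V=I\circ J)$ for $t_1\circ t_2$, $\circ\in\{+,-,\times\}$; for $t_1/t_2$: $\exists I,J,K(\mathrm{val}_{t_1}(I)\wedge\mathrm{val}_{t_2}(J)\wedge K\times|J|\le|I|<(K+\overline1)\times|J|\wedge((I\times J\ge\overline0\wedge V=K)\vee(I\times J<\overline0\wedge V=-K)))$; for $t_1\backslash t_2$ the same but with $V=I-K\times J$ in the first disjunct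 and $V=I+K\times J$ in the second; for $t_1..t_2$: $\exists I,J,K(\mathrm{val}_{t_1}(I)\wedge\mathrm{val}_{t_2}(J)\wedge I\le K\le J\wedge V=K)$; here $I,J,K$ are fresh integer variables; for tuples, the conjunction. $\tau^B(p(\mathbf t))=\exists\mathbf V(\mathrm{val}_{\mathbf t}(\mathbf V)\wedge p(\mathbf V))$, similarly with $\neg p(\mathbf V)$ and $\neg\neg p(\mathbf V)$ for $\mathit{not}\,p(\mathbf t)$, $\mathit{not}\,\mathit{not}\,p(\mathbf t)$; $\tau^B(t_1\prec t_2)=\exists V_1V_2(\mathrm{val}_{t_1}(V_1)\wedge\mathrm{val}_{t_2}(V_2)\wedge V_1\prec V_2)$; conjunctions componentwise. For a basic or choice rule $R$ with head atom $p(\mathbf t)$ and fresh variables $\mathbf X$: $\mathrm{Form}(R,\mathbf X)=\mathrm{val}_{\mathbf t}(\mathbf X)\wedge\tau^B(\mathrm{Body}(R))$ for basic rules and additionally $\wedge\neg\neg p(\mathbf X)$ for choice rules. Ordered completion. For each pair of predicates $p,q$ introduce a new predicate $<_{pq}$ of arity $\mathrm{ar}(p)+\mathrm{ar}(q)$, written $\mathbf x<_{pq}\mathbf y$; $\sigma_0^<$ is $\sigma_0$ extended by these. For $p\in\mathcal L(\Pi)$, with $\mathbf X,\mathbf Z$ fresh program variables of the arities of $p,q$ and $\mathbf Y$ the free variables of $\mathrm{Form}(R,\mathbf X)$ other than $\mathbf X$: $\mathrm{Comp}^{\leftarrow}(p)=\forall\mathbf X\big(\bigvee_{R\in\Pi,\mathrm{HeadLit}(R)=p(\mathbf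 t)}\exists\mathbf Y\,\mathrm{Form}(R,\mathbf X)\to p(\mathbf X)\big)$, $\mathrm{OComp}^{\to}(p)=\forall\mathbf X\big(p(\mathbf X)\to\bigvee_{R\in\Pi,\mathrm{HeadLit}(R)=p(\mathbf t)}\exists\mathbf Y(\mathrm{Form}(R,\mathbf X)\wedge\bigwedge_{q(\mathbf t')\in B^+(R)}\exists\mathbf Z(\mathrm{val}_{\mathbf t'}(\mathbf Z)\wedge q(\mathbf Z)\wedge\mathbf Z<_{qp}\mathbf X))\big)$. $\mathrm{Cons}(\Pi)=\bigwedge_{R\text{ constraint in }\Pi}\forall\mathbf U\,\neg\tau^B(\mathrm{Body}(R))$ ($\mathbf U$ its free variables). $\mathrm{Irref}(\Pi)=\bigwedge_{p\in\mathcal L(\Pi)}\forall\mathbf X\neg(\mathbf X<_{pp}\mathbf X)$; $\mathrm{Trans}(\Pi)=\bigwedge_{p,q,r\in\mathcal L(\Pi)}\forall\mathbf X\mathbf Y\mathbf Z(\mathbf X<_{pq}\mathbf Y\wedge\mathbf Y<_{qr}\mathbf Z\to\mathbf X<_{pr}\mathbf Z)$. $\mathrm{OC}(\Pi)=\mathrm{Cons}(\Pi)\wedge\mathrm{Irref}(\Pi)\wedge\mathrm{Trans}(\Pi)\wedge\bigwedge_{p\in\mathcal L(\Pi)}(\mathrm{Comp}^{\leftarrow}(p)\wedge\mathrm{OComp}^{\to}(p))$.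
   Formalization: The formal statement additionally requires every atom of I to have its predicate p/n in L(Π); without this the claim fails (Π empty, I = {a}: OC(Π) is a tautology, but I is not stable). *)

(* Defs.v *)
From Stdlib Require Import ZArith List Arith PeanoNat.
From Stdlib Require Import Ensembles Finite_sets ClassicalEpsilon.
Import ListNotations.

(** * Mini-gringo syntax *)

(* The fixed countably infinite sets of symbolic constants and of program
   variables are represented by indices; the numerals are [Num n], [n : Z]. *)
Definition symbol := nat.
Definition pvar := nat.

Inductive precomp : Type :=
| Inf
| Num (n : Z)
| Sym (s : symbol)
| Sup.

Definition precomp_eq_dec (c d : precomp) : {c = d} + {c <> d}.
Proof. decide equality; [apply Z.eq_dec | apply Nat.eq_dec]. Defined.

(* The strict version of the total order on precomputed terms.  The relative
   position of the symbolic constants is left open. *)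
Record precomp_order (lt : precomp -> precomp -> bool) : Prop := {
  lt_irrefl : forall c, lt c c = false;
  lt_trans : forall c d e, lt c d = true -> lt d e = true -> lt c e = true;
  lt_total : forall c d, lt c d = true \/ c = d \/ lt d c = true;
  lt_inf : forall c, c <> Inf -> lt Inf c = true;
  lt_sup : forall c, c <> Sup -> lt c Sup = true;
  lt_num : forall m n, lt (Num m) (Num n) = true <-> (m < n)%Z
}.

Inductive arith_op : Type := Plus | Minus | Times.

Inductive pterm : Type :=
| TConst (c : precomp)
| TVar (x : pvar)
| TAbs (t : pterm)
| TArith (o : arith_op) (t1 t2 : pterm)
| TDiv (t1 t2 : pterm)
| TMod (t1 t2 : pterm)
| TInterval (t1 t2 : pterm).

Inductive cmp_op : Type := CEq | CNe | CLt | CGt | CLe | CGe.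

Record atom : Type := Atom { asym : symbol; aargs : list pterm }.

Inductive body_elt : Type :=
| Pos (a : atom)
| Not (a : atom)
| NotNot (a : atom)
| Cmp (o : cmp_op) (t1 t2 : pterm).

Inductive rule_head : Type :=
| Basic (a : atom)
| Choice (a : atom)
| Constraint.

Record rule : Type := Rule { head : rule_head; body : list body_elt }.

Definition head_lit (R : rule) : option atom :=
  match head R with
  | Basic a | Choice a => Some a
  | Constraint => None
  end.

Definition body_pos (R : rule) : list atom :=
  flat_map (fun b => match b with Pos a => [a] | _ => [] end) (body R).

(* A predicate p/n. *)
Definition pred : Type := (symbol * nat)%type.

Definition pred_eq_dec (p q : pred) : {p = q} + {p <> q}.
Proof. decide equality; apply Nat.eq_dec. Defined.

Definition atom_pred (a : atom) : pred := (asym a, length (aargs a)).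

Definition body_elt_atoms (b : body_elt) : list atom :=
  match b with
  | Pos a | Not a | NotNot a => [a]
  | Cmp _ _ _ => []
  end.

Definition rule_atoms (R : rule) : list atom :=
  match head_lit R with Some a => [a] | None => [] end
  ++ flat_map body_elt_atoms (body R).

Definition rules_preds (rs : list rule) : list pred :=
  nodup pred_eq_dec (map atom_pred (flat_map rule_atoms rs)).

Record program : Type := Program {
  rules : list rule;
  single_arity : forall p m n,
    List.In (p, m) (rules_preds rules) ->
    List.In (p, n) (rules_preds rules) -> m = n
}.

Definition preds (Pi : program) : list pred := rules_preds (rules Pi).

(** * Instances *)

Section Instances.
Variable s : pvar -> precomp.

Fixpoint inst_term (t : pterm) : pterm :=
  match t with
  | TConst c => TConst c
  | TVar x => TConst (s x)
  | TAbs t1 => TAbs (inst_term t1)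
  | TArith o t1 t2 => TArith o (inst_term t1) (inst_term t2)
  | TDiv t1 t2 => TDiv (inst_term t1) (inst_term t2)
  | TMod t1 t2 => TMod (inst_term t1) (inst_term t2)
  | TInterval t1 t2 => TInterval (inst_term t1) (inst_term t2)
  end.

Definition inst_atom (a : atom) : atom :=
  Atom (asym a) (map inst_term (aargs a)).

Definition inst_body_elt (b : body_elt) : body_elt :=
  match b with
  | Pos a => Pos (inst_atom a)
  | Not a => Not (inst_atom a)
  | NotNot a => NotNot (inst_atom a)
  | Cmp o t1 t2 => Cmp o (inst_term t1) (inst_term t2)
  end.

Definition inst_head (h : rule_head) : rule_head :=
  match h with
  | Basic a => Basic (inst_atom a)
  | Choice a => Choice (inst_atom a)
  | Constraint => Constraint
  end.

Definition inst_rule (R : rule) : rule :=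
  Rule (inst_head (head R)) (map inst_body_elt (body R)).

End Instances.

(** * Values of ground terms *)

Definition arith_fun (o : arith_op) : Z -> Z -> Z :=
  match o with Plus => Z.add | Minus => Z.sub | Times => Z.mul end.

Definition nums (l : list precomp) : list Z :=
  flat_map (fun c => match c with Num n => [n] | _ => [] end) l.

Definition num_pairs (l1 l2 : list precomp) : list (Z * Z) :=
  list_prod (nums l1) (nums l2).

Definition nonzero_divisor (n : Z * Z) : bool := negb (snd n =? 0)%Z.

Definition zinterval (m n : Z) : list Z :=
  map (fun i => (m + Z.of_nat i)%Z) (List.seq 0 (Z.to_nat (n - m + 1))).

(* A finite set is represented by a list of its elements, possibly with
   repetitions.  [Z.quot] rounds toward zero.  The value at a variable is never
   used: [vals] is applied to ground terms only. *)
Fixpoint vals (t : pterm) : list precomp :=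
  match t with
  | TConst c => [c]
  | TVar _ => []
  | TAbs t1 => map (fun n => Num (Z.abs n)) (nums (vals t1))
  | TArith o t1 t2 =>
      map (fun n => Num (arith_fun o (fst n) (snd n)))
        (num_pairs (vals t1) (vals t2))
  | TDiv t1 t2 =>
      map (fun n => Num (Z.quot (fst n) (snd n)))
        (filter nonzero_divisor (num_pairs (vals t1) (vals t2)))
  | TMod t1 t2 =>
      map (fun n => Num (fst n - snd n * Z.quot (fst n) (snd n)))
        (filter nonzero_divisor (num_pairs (vals t1) (vals t2)))
  | TInterval t1 t2 =>
      map Num (flat_map (fun n => zinterval (fst n) (snd n))
                 (num_pairs (vals t1) (vals t2)))
  end.

Fixpoint vals_tuple (ts : list pterm) : list (list precomp) :=
  match ts with
  | [] => [[]]
  | t :: ts' => flat_map (fun r => map (cons r) (vals_tuple ts')) (vals t)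
  end.

(** * Propositional formulas, reducts, stable models *)

(* The precomputed atom p(r) is the pair [(p, r)]. *)
Definition patom : Type := (symbol * list precomp)%type.

Definition patom_pred (a : patom) : pred := (fst a, length (snd a)).

Inductive pform : Type :=
| PBot
| PAtom (a : patom)
| PAnd (F G : pform)
| POr (F G : pform)
| PImp (F G : pform).

Definition PNeg (F : pform) : pform := PImp F PBot.
Definition PTop : pform := PNeg PBot.
Definition PBigAnd (l : list pform) : pform := fold_right PAnd PTop l.
Definition PBigOr (l : list pform) : pform := fold_right POr PBot l.

Fixpoint psat (I : Ensemble patom) (F : pform) : Prop :=
  match F with
  | PBot => False
  | PAtom a => I a
  | PAnd G H => psat I G /\ psat I H
  | POr G H => psat I G \/ psat I H
  | PImp G H => psat I G -> psat I H
  end.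

Fixpoint preduct (I : Ensemble patom) (F : pform) : pform :=
  if excluded_middle_informative (psat I F) then
    match F with
    | PBot => PBot
    | PAtom a => PAtom a
    | PAnd G H => PAnd (preduct I G) (preduct I H)
    | POr G H => POr (preduct I G) (preduct I H)
    | PImp G H => PImp (preduct I G) (preduct I H)
    end
  else PBot.

Section Tau.
Variable lt : precomp -> precomp -> bool.

Definition cmpb (o : cmp_op) (c d : precomp) : bool :=
  let eqb := if precomp_eq_dec c d then true else false in
  match o with
  | CEq => eqb
  | CNe => negb eqb
  | CLt => lt c d
  | CGt => lt d c
  | CLe => lt c d || eqb
  | CGe => lt d c || eqb
  end.

Definition ground_atoms (a : atom) : list pform :=
  map (fun r => PAtom (asym a, r)) (vals_tuple (aargs a)).

Definition tau_body_elt (b : body_elt) : pform :=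
  match b with
  | Pos a => PBigOr (ground_atoms a)
  | Not a => PBigOr (map PNeg (ground_atoms a))
  | NotNot a => PBigOr (map (fun F => PNeg (PNeg F)) (ground_atoms a))
  | Cmp o t1 t2 =>
      if existsb (fun r1 => existsb (cmpb o r1) (vals t2)) (vals t1)
      then PTop else PBot
  end.

Definition tau_body (B : list body_elt) : pform :=
  PBigAnd (map tau_body_elt B).

Definition tau_rule (R : rule) : pform :=
  match head R with
  | Basic a => PImp (tau_body (body R)) (PBigAnd (ground_atoms a))
  | Choice a =>
      PImp (tau_body (body R))
        (PBigAnd (map (fun F => POr F (PNeg F)) (ground_atoms a)))
  | Constraint => PNeg (tau_body (body R))
  end.

Definition tau (Pi : program) : Ensemble pform :=
  fun F => exists (R : rule) (s : pvar -> precomp),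
    List.In R (rules Pi) /\ F = tau_rule (inst_rule s R).

Definition reduct_model (Pi : program) (I I' : Ensemble patom) : Prop :=
  forall F, tau Pi F -> psat I' (preduct I F).

Definition stable_model (Pi : program) (I : Ensemble patom) : Prop :=
  reduct_model Pi I I /\
  forall I', Included patom I' I -> reduct_model Pi I I' ->
    Same_set patom I' I.

End Tau.

(** * Two-sorted formulas over the signature with the predicates [<_pq] *)

Definition ivar := nat.

Inductive var : Type :=
| PV (x : pvar)
| IV (n : ivar).

Definition var_eq_dec (x y : var) : {x = y} + {x <> y}.
Proof. decide equality; apply Nat.eq_dec. Defined.

Inductive iterm : Type :=
| INum (n : Z)
| IVar (n : ivar)
| IAbs (t : iterm)
| IArith (o : arith_op) (t1 t2 : iterm).

Inductive gterm : Type :=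
| GInf
| GSup
| GSym (s : symbol)
| GVar (x : pvar)
| GInt (t : iterm).

Definition const_term (c : precomp) : gterm :=
  match c with
  | Inf => GInf
  | Num n => GInt (INum n)
  | Sym s => GSym s
  | Sup => GSup
  end.

Definition var_term (x : var) : gterm :=
  match x with
  | PV v => GVar v
  | IV n => GInt (IVar n)
  end.

(* The arity of a predicate is given by the number of its arguments:
   [FAtom p ts] applies p/n with n = length ts, and [FPrec p q ts us] is the
   atomic formula ts <_pq us for the predicates p/(length ts), q/(length us). *)
Inductive form : Type :=
| FBot
| FAtom (p : symbol) (ts : list gterm)
| FCmp (o : cmp_op) (t u : gterm)
| FPrec (p q : symbol) (ts us : list gterm)
| FAnd (F G : form)
| FOr (F G : form)
| FImp (F G : form)
| FAll (x : var) (F : form)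
| FEx (x : var) (F : form).

Definition FNeg (F : form) : form := FImp F FBot.
Definition FTop : form := FNeg FBot.
Definition FBigAnd (l : list form) : form := fold_right FAnd FTop l.
Definition FBigOr (l : list form) : form := fold_right FOr FBot l.
Definition FAlls (xs : list var) (F : form) : form := fold_right FAll F xs.
Definition FExs (xs : list var) (F : form) : form := fold_right FEx F xs.

Fixpoint iterm_vars (t : iterm) : list var :=
  match t with
  | INum _ => []
  | IVar n => [IV n]
  | IAbs t1 => iterm_vars t1
  | IArith _ t1 t2 => iterm_vars t1 ++ iterm_vars t2
  end.

Definition gterm_vars (t : gterm) : list var :=
  match t with
  | GVar x => [PV x]
  | GInt t1 => iterm_vars t1
  | _ => []
  end.

Definition remove_vars (xs ys : list var) : list var :=
  filter (fun y => if in_dec var_eq_dec y xs then false else true) ys.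

Fixpoint free_occs (F : form) : list var :=
  match F with
  | FBot => []
  | FAtom _ ts => flat_map gterm_vars ts
  | FCmp _ t u => gterm_vars t ++ gterm_vars u
  | FPrec _ _ ts us => flat_map gterm_vars ts ++ flat_map gterm_vars us
  | FAnd G H | FOr G H | FImp G H => free_occs G ++ free_occs H
  | FAll x G | FEx x G => remove_vars [x] (free_occs G)
  end.

Definition free_vars (F : form) : list var := nodup var_eq_dec (free_occs F).

(** * Interpretations *)

(* Interpretations of the signature without the predicates [<_pq].  The subsort
   integer of general is represented by an injection between the domains. *)
Record interp0 : Type := Interp0 {
  gdom : Type;
  idom : Type;
  incl : idom -> gdom;
  incl_inj : forall a b, incl a = incl b -> a = b;
  i_inf : gdom;
  i_sup : gdom;
  i_sym : symbol -> gdom;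
  i_num : Z -> idom;
  i_abs : idom -> idom;
  i_arith : arith_op -> idom -> idom -> idom;
  i_pred : symbol -> list gdom -> Prop;
  i_cmp : cmp_op -> gdom -> gdom -> Prop
}.

Record interp : Type := Interp {
  reduct0 : interp0;
  i_prec : symbol -> symbol -> list (gdom reduct0) -> list (gdom reduct0) -> Prop
}.

Record assignment (M : interp0) : Type := Assignment {
  a_gen : pvar -> gdom M;
  a_int : ivar -> idom M
}.
Arguments Assignment {M}.
Arguments a_gen {M}.
Arguments a_int {M}.

Definition set_gen {M : interp0} (e : assignment M) (x : pvar) (d : gdom M) :
  assignment M :=
  Assignment (fun y => if Nat.eq_dec y x then d else a_gen e y) (a_int e).

Definition set_int {M : interp0} (e : assignment M) (n : ivar) (d : idom M) :
  assignment M :=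
  Assignment (a_gen e) (fun m => if Nat.eq_dec m n then d else a_int e m).

Fixpoint eval_iterm {M : interp0} (e : assignment M) (t : iterm) : idom M :=
  match t with
  | INum n => i_num M n
  | IVar n => a_int e n
  | IAbs t1 => i_abs M (eval_iterm e t1)
  | IArith o t1 t2 => i_arith M o (eval_iterm e t1) (eval_iterm e t2)
  end.

Definition eval_gterm {M : interp0} (e : assignment M) (t : gterm) : gdom M :=
  match t with
  | GInf => i_inf M
  | GSup => i_sup M
  | GSym s => i_sym M s
  | GVar x => a_gen e x
  | GInt t1 => incl M (eval_iterm e t1)
  end.

Fixpoint sat (J : interp) (e : assignment (reduct0 J)) (F : form) : Prop :=
  match F with
  | FBot => False
  | FAtom p ts => i_pred (reduct0 J) p (map (eval_gterm e) ts)
  | FCmp o t u => i_cmp (reduct0 J) o (eval_gterm e t) (eval_gterm e u)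
  | FPrec p q ts us =>
      i_prec J p q (map (eval_gterm e) ts) (map (eval_gterm e) us)
  | FAnd G H => sat J e G /\ sat J e H
  | FOr G H => sat J e G \/ sat J e H
  | FImp G H => sat J e G -> sat J e H
  | FAll (PV x) G => forall d, sat J (set_gen e x d) G
  | FAll (IV n) G => forall d, sat J (set_int e n d) G
  | FEx (PV x) G => exists d, sat J (set_gen e x d) G
  | FEx (IV n) G => exists d, sat J (set_int e n d) G
  end.

Definition is_model (J : interp) (F : form) : Prop := forall e, sat J e F.

Lemma Num_inj (m n : Z) : Num m = Num n -> m = n.
Proof. congruence. Qed.

Definition std_interp (lt : precomp -> precomp -> bool) (I : Ensemble patom) :
  interp0 := {|
  gdom := precomp;
  idom := Z;
  incl := Num;
  incl_inj := Num_inj;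
  i_inf := Inf;
  i_sup := Sup;
  i_sym := Sym;
  i_num := fun n => n;
  i_abs := Z.abs;
  i_arith := arith_fun;
  i_pred := fun p r => I (p, r);
  i_cmp := fun o c d => cmpb lt o c d = true
|}.

(** * The formulas val_t(V), tau^B and Form *)

(* Integer variables with index at least [fresh_ivar V] differ from [V].  Program
   terms contain no integer variables, so they are fresh for val_t(V). *)
Definition fresh_ivar (V : var) : ivar :=
  match V with
  | PV _ => 0
  | IV n => S n
  end.

Definition FEqV (V : var) (t : iterm) : form := FCmp CEq (var_term V) (GInt t).

(* K * |J| <= |I| < (K + 1) * |J|
   /\ ((I * J >= 0 /\ V = r1) \/ (I * J < 0 /\ V = r2)) *)
Definition val_div_matrix (V : var) (I J K r1 r2 : iterm) : form :=
  FAnd (FCmp CLe (GInt (IArith Times K (IAbs J))) (GInt (IAbs I)))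
  (FAnd (FCmp CLt (GInt (IAbs I))
                  (GInt (IArith Times (IArith Plus K (INum 1)) (IAbs J))))
  (FOr (FAnd (FCmp CGe (GInt (IArith Times I J)) (GInt (INum 0))) (FEqV V r1))
       (FAnd (FCmp CLt (GInt (IArith Times I J)) (GInt (INum 0))) (FEqV V r2)))).

(* The term -K in the clause for division is 0 - K. *)
Fixpoint val (t : pterm) (V : var) : form :=
  let i := fresh_ivar V in
  let j := S i in
  let k := S j in
  let I := IVar i in
  let J := IVar j in
  let K := IVar k in
  match t with
  | TConst c => FCmp CEq (var_term V) (const_term c)
  | TVar x => FCmp CEq (var_term V) (GVar x)
  | TAbs t1 => FEx (IV i) (FAnd (val t1 (IV i)) (FEqV V (IAbs I)))
  | TArith o t1 t2 =>
      FExs [IV i; IV j]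
        (FAnd (val t1 (IV i)) (FAnd (val t2 (IV j)) (FEqV V (IArith o I J))))
  | TDiv t1 t2 =>
      FExs [IV i; IV j; IV k]
        (FAnd (val t1 (IV i)) (FAnd (val t2 (IV j))
           (val_div_matrix V I J K K (IArith Minus (INum 0) K))))
  | TMod t1 t2 =>
      FExs [IV i; IV j; IV k]
        (FAnd (val t1 (IV i)) (FAnd (val t2 (IV j))
           (val_div_matrix V I J K
              (IArith Minus I (IArith Times K J))
              (IArith Plus I (IArith Times K J)))))
  | TInterval t1 t2 =>
      FExs [IV i; IV j; IV k]
        (FAnd (val t1 (IV i)) (FAnd (val t2 (IV j))
           (FAnd (FCmp CLe (GInt I) (GInt K))
           (FAnd (FCmp CLe (GInt K) (GInt J)) (FEqV V K)))))
  end.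

Definition val_tuple (ts : list pterm) (Vs : list var) : form :=
  FBigAnd (map (fun tV => val (fst tV) (snd tV)) (combine ts Vs)).

(* All program variables of [t] have an index smaller than [term_bound t]. *)
Fixpoint term_bound (t : pterm) : nat :=
  match t with
  | TConst _ => 0
  | TVar x => S x
  | TAbs t1 => term_bound t1
  | TArith _ t1 t2 | TDiv t1 t2 | TMod t1 t2 | TInterval t1 t2 =>
      Nat.max (term_bound t1) (term_bound t2)
  end.

Definition terms_bound (ts : list pterm) : nat := list_max (map term_bound ts).

Definition pvars_from (m n : nat) : list var := map PV (List.seq m n).

Definition atom_form (p : symbol) (Vs : list var) : form :=
  FAtom p (map var_term Vs).

Definition tauB_atom (a : atom) (f : form -> form) : form :=
  let Vs := pvars_from (terms_bound (aargs a)) (length (aargs a)) in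
  FExs Vs (FAnd (val_tuple (aargs a) Vs) (f (atom_form (asym a) Vs))).

Definition tauB_body_elt (b : body_elt) : form :=
  match b with
  | Pos a => tauB_atom a (fun F => F)
  | Not a => tauB_atom a FNeg
  | NotNot a => tauB_atom a (fun F => FNeg (FNeg F))
  | Cmp o t1 t2 =>
      let m := terms_bound [t1; t2] in
      let V1 := PV m in
      let V2 := PV (S m) in
      FExs [V1; V2]
        (FAnd (val t1 V1) (FAnd (val t2 V2) (FCmp o (var_term V1) (var_term V2))))
  end.

Definition tauB_body (B : list body_elt) : form :=
  FBigAnd (map tauB_body_elt B).

(* [Form] is defined for basic and choice rules; its value for constraints is
   never used. *)
Definition Form (R : rule) (X : list var) : form :=
  match head R with
  | Basic a => FAnd (val_tuple (aargs a) X) (tauB_body (body R))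
  | Choice a =>
      FAnd (FAnd (val_tuple (aargs a) X) (tauB_body (body R)))
           (FNeg (FNeg (atom_form (asym a) X)))
  | Constraint => FBot
  end.

(** * Ordered completion *)

Definition body_elt_terms (b : body_elt) : list pterm :=
  match b with
  | Pos a | Not a | NotNot a => aargs a
  | Cmp _ t1 t2 => [t1; t2]
  end.

Definition rule_terms (R : rule) : list pterm :=
  match head_lit R with Some a => aargs a | None => [] end
  ++ flat_map body_elt_terms (body R).

Section OrderedCompletion.
Variable Pi : program.

Definition program_bound : nat :=
  terms_bound (flat_map rule_terms (rules Pi)).

Definition rules_for (p : pred) : list rule :=
  filter (fun R => match head_lit R with
                   | Some a => if pred_eq_dec (atom_pred a) p then true else false
                   | None => false
                   end) (rules Pi).

Definition head_vars (p : pred) : list var := pvars_from program_bound (snd p).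

Definition other_free_vars (R : rule) (X : list var) : list var :=
  remove_vars X (free_vars (Form R X)).

Definition Comp_left (p : pred) : form :=
  let X := head_vars p in
  FAlls X
    (FImp
       (FBigOr (map (fun R => FExs (other_free_vars R X) (Form R X))
                    (rules_for p)))
       (atom_form (fst p) X)).

(* The conjunct for a positive body atom q(t'); the variables [Z] follow the
   variables [X] of [head_vars p]. *)
Definition prec_conjunct (p : pred) (X : list var) (a : atom) : form :=
  let Z := pvars_from (program_bound + snd p) (length (aargs a)) in
  FExs Z
    (FAnd (val_tuple (aargs a) Z)
    (FAnd (atom_form (asym a) Z)
          (FPrec (asym a) (fst p) (map var_term Z) (map var_term X)))).

Definition OComp_right (p : pred) : form :=
  let X := head_vars p in
  FAlls X
    (FImp
       (atom_form (fst p) X)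
       (FBigOr (map (fun R =>
          FExs (other_free_vars R X)
            (FAnd (Form R X)
                  (FBigAnd (map (prec_conjunct p X) (body_pos R)))))
          (rules_for p)))).

Definition is_constraint (R : rule) : bool :=
  match head R with Constraint => true | _ => false end.

Definition Cons : form :=
  FBigAnd (map (fun R =>
      let F := FNeg (tauB_body (body R)) in FAlls (free_vars F) F)
    (filter is_constraint (rules Pi))).

Definition Irref : form :=
  FBigAnd (map (fun p : pred =>
      let X := pvars_from 0 (snd p) in
      FAlls X (FNeg (FPrec (fst p) (fst p) (map var_term X) (map var_term X))))
    (preds Pi)).

Definition Trans_for (p q r : pred) : form :=
  let X := pvars_from 0 (snd p) in
  let Y := pvars_from (snd p) (snd q) in
  let Z := pvars_from (snd p + snd q) (snd r) in
  FAlls (X ++ Y ++ Z)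
    (FImp
       (FAnd (FPrec (fst p) (fst q) (map var_term X) (map var_term Y))
             (FPrec (fst q) (fst r) (map var_term Y) (map var_term Z)))
       (FPrec (fst p) (fst r) (map var_term X) (map var_term Z))).

Definition Trans : form :=
  FBigAnd (flat_map (fun p => flat_map (fun q =>
      map (Trans_for p q) (preds Pi)) (preds Pi)) (preds Pi)).

Definition OC : form :=
  FAnd Cons (FAnd Irref (FAnd Trans
    (FBigAnd (map (fun p => FAnd (Comp_left p) (OComp_right p)) (preds Pi))))).

End OrderedCompletion.

(* Main.v *)
(** On subsets of [I], the models of the reduct of [tau Pi] with respect to [I]
    are the sets closed under an immediate consequence operator, so [I] is stable
    iff it satisfies [tau Pi] and is included in every closed subset of itself.
    If [I] is stable, it is the union of the finite stages of this operator, and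
    comparing stages gives the order: [a] precedes [b] when some stage contains
    [a] but not [b].  Conversely, if a closed subset [I'] missed part of the
    finite set [I], a minimal atom of [I] outside [I'] would, by the ordered
    completion, be derived from strictly smaller atoms of [I], which are in [I']. *)

Require Import Defs.
From Stdlib Require Import List Ensembles Finite_sets.
From Stdlib Require Import ZArith Lia Bool.
From Stdlib Require Import Classical ClassicalEpsilon FunctionalExtensionality.
Import ListNotations.

(** Basic and choice rules yield the same closure condition. The reduct of a choice head forces an
    atom only if that atom is in [I], and the atoms of a basic head with true body are in [I] as
    soon as [I] satisfies [tau Pi]; hence closure is tested on atoms of [I] only. Negated literals
    and comparisons keep in the reduct the truth value they have in [I]. Only positive body atoms
    see the smaller set, which makes the operator monotone and explains why the order is imposed on
    positive body atoms alone. Finiteness matters because irreflexivity and transitivity do not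
    exclude infinite descending chains, along which the atoms of an infinite set could support one
    another forever. Most of the work lies in passing between formulas and ground instances. The
    general part [a_gen e] of an assignment is read as the substitution that produces an instance,
    and freshness of program variables becomes arithmetic on indices: they are taken in blocks above
    every index that occurs in the terms concerned. *)

Lemma psat_PBigAnd (I : Ensemble patom) (l : list pform) :
  psat I (PBigAnd l) <-> forall F, List.In F l -> psat I F.
Proof.
  induction l as [|G l IH]; simpl.
  - split; [intros _ F [] | tauto].
  - change (fold_right PAnd PTop l) with (PBigAnd l). rewrite IH. split.
    + intros [HG Hl] F [<- | HF]; auto.
    + intros H. split; auto.
Qed.

Lemma psat_PBigOr (I : Ensemble patom) (l : list pform) :
  psat I (PBigOr l) <-> exists F, List.In F l /\ psat I F.
Proof.
  induction l as [|G l IH]; simpl.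
  - split; [intros [] | intros [F [[] _]]].
  - change (fold_right POr PBot l) with (PBigOr l). rewrite IH. split.
    + intros [HG | [F [HF HS]]]; eauto.
    + intros [F [[<- | HF] HS]]; eauto.
Qed.

(** * Reducts of propositional formulas *)

Section Reduct.
Variables I I' : Ensemble patom.

(** A formula false in [I] reduces to [PBot], which nothing satisfies. This fact absorbs the case
    distinction inside [preduct], so the lemmas below can treat reducts connective by connective. *)
Lemma preduct_psat (F : pform) : psat I' (preduct I F) -> psat I F.
Proof.
  destruct F; simpl; destruct (excluded_middle_informative _) as [H | H];
    simpl; tauto.
Qed.

Lemma preduct_and (F G : pform) :
  psat I' (preduct I (PAnd F G)) <->
  psat I' (preduct I F) /\ psat I' (preduct I G).
Proof.
  pose proof (preduct_psat F); pose proof (preduct_psat G).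
  simpl; destruct (excluded_middle_informative _); simpl; tauto.
Qed.

Lemma preduct_or (F G : pform) :
  psat I' (preduct I (POr F G)) <->
  psat I' (preduct I F) \/ psat I' (preduct I G).
Proof.
  pose proof (preduct_psat F); pose proof (preduct_psat G).
  simpl; destruct (excluded_middle_informative _); simpl; tauto.
Qed.

(** The first conjunct says that the implication survives the reduct at all; it does not follow from
    the second, which may hold just because [I'] falsifies the reduct of [F]. *)
Lemma preduct_imp (F G : pform) :
  psat I' (preduct I (PImp F G)) <->
  (psat I F -> psat I G) /\ (psat I' (preduct I F) -> psat I' (preduct I G)).
Proof.
  simpl; destruct (excluded_middle_informative _); simpl; tauto.
Qed.

Lemma preduct_bot : ~ psat I' (preduct I PBot).
Proof. simpl; destruct (excluded_middle_informative _); simpl; tauto. Qed.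

(** If [I] falsifies [F], the reduct is [PBot -> PBot]. The value is therefore independent of [I']:
    negated literals are frozen at [I]. *)
Lemma preduct_neg (F : pform) : psat I' (preduct I (PNeg F)) <-> ~ psat I F.
Proof.
  unfold PNeg. rewrite preduct_imp.
  pose proof (preduct_psat F); pose proof preduct_bot. simpl psat at 2. tauto.
Qed.

Lemma preduct_atom (a : patom) : psat I' (preduct I (PAtom a)) <-> I a /\ I' a.
Proof. simpl; destruct (excluded_middle_informative _); simpl; tauto. Qed.

Lemma preduct_PBigAnd (l : list pform) :
  psat I' (preduct I (PBigAnd l)) <->
  forall F, List.In F l -> psat I' (preduct I F).
Proof.
  induction l as [|G l IH].
  - change (PBigAnd []) with (PNeg PBot). rewrite preduct_neg. simpl. tauto.
  - change (PBigAnd (G :: l)) with (PAnd G (PBigAnd l)).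
    rewrite preduct_and, IH. split.
    + intros [HG Hl] F [<- | HF]; auto.
    + intros H. split; [apply H; now left | intros F HF; apply H; now right].
Qed.

Lemma preduct_PBigOr (l : list pform) :
  psat I' (preduct I (PBigOr l)) <->
  exists F, List.In F l /\ psat I' (preduct I F).
Proof.
  induction l as [|G l IH].
  - pose proof preduct_bot. split; [tauto | intros [F [[] _]]].
  - change (PBigOr (G :: l)) with (POr G (PBigOr l)).
    rewrite preduct_or, IH. split.
    + intros [HG | [F [HF HS]]]; [exists G | exists F]; simpl; auto.
    + intros [F [[<- | HF] HS]]; eauto.
Qed.

End Reduct.

Lemma preduct_self (I : Ensemble patom) (F : pform) :
  psat I (preduct I F) <-> psat I F.
Proof.
  induction F.
  - split; [apply preduct_psat | intros []].
  - rewrite preduct_atom. simpl. tauto.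
  - rewrite preduct_and. simpl. tauto.
  - rewrite preduct_or. simpl. tauto.
  - rewrite preduct_imp. simpl. tauto.
Qed.

(** * Stable models as least fixed points *)

Definition pos_supported (X : Ensemble patom) (G : rule) : Prop :=
  forall a, List.In a (body_pos G) ->
  exists r, List.In r (vals_tuple (aargs a)) /\ X (asym a, r).

(** The immediate consequence operator. The whole body is evaluated in [I], and its positive atoms a
    second time in [X]. Basic and choice heads are not distinguished; membership of [pa] in [I] is
    added wherever the operator is used. *)
Definition supported (lt : precomp -> precomp -> bool) (Pi : program)
  (I X : Ensemble patom) (pa : patom) : Prop :=
  exists R s h, List.In R (rules Pi) /\
    head_lit (inst_rule s R) = Some h /\ fst pa = asym h /\
    List.In (snd pa) (vals_tuple (aargs h)) /\
    psat I (tau_body lt (body (inst_rule s R))) /\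
    pos_supported X (inst_rule s R).

Lemma in_body_pos (G : rule) (a : atom) :
  List.In a (body_pos G) <-> List.In (Pos a) (body G).
Proof.
  unfold body_pos. rewrite in_flat_map. split.
  - intros [b [Hb Ha]]. destruct b; simpl in Ha; try tauto.
    destruct Ha as [<- | []]; auto.
  - intros H. exists (Pos a). simpl. auto.
Qed.

Section StableModels.
Variable lt : precomp -> precomp -> bool.

(** Each conjunct is a disjunction over values. The disjuncts of a positive literal survive only in
    both [I] and [I'], where [HI'] makes the second membership enough; all other conjuncts depend on
    [I] alone. *)
Lemma preduct_body (I I' : Ensemble patom) (G : rule) (HI' : Included patom I' I) :
  psat I' (preduct I (tau_body lt (body G))) <->
  psat I (tau_body lt (body G)) /\ pos_supported I' G.
Proof.
  split.
  - intros H. split; [exact (preduct_psat _ _ _ H) |].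
    intros a Ha. apply in_body_pos in Ha.
    unfold tau_body in H. rewrite preduct_PBigAnd in H.
    specialize (H _ (in_map (tau_body_elt lt) _ _ Ha)). simpl in H.
    apply preduct_PBigOr in H. destruct H as [F [HF HS]].
    apply in_map_iff in HF. destruct HF as [r [<- Hr]].
    apply preduct_atom in HS. exists r. tauto.
  - intros [HB HP]. unfold tau_body in *.
    rewrite psat_PBigAnd in HB. rewrite preduct_PBigAnd.
    intros F HF. specialize (HB F HF).
    apply in_map_iff in HF. destruct HF as [b [<- Hb]].
    destruct b as [a | a | a | o t1 t2]; simpl in *.
    + apply in_body_pos in Hb. destruct (HP a Hb) as [r [Hr Ir]].
      apply preduct_PBigOr. exists (PAtom (asym a, r)). split.
      * now apply (in_map (fun r => PAtom (asym a, r))).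
      * apply preduct_atom. split; [now apply HI' | assumption].
    + apply psat_PBigOr in HB. destruct HB as [F [HF HS]].
      apply preduct_PBigOr. exists F. split; [assumption |].
      apply in_map_iff in HF. destruct HF as [F' [<- _]].
      now apply preduct_neg.
    + apply psat_PBigOr in HB. destruct HB as [F [HF HS]].
      apply preduct_PBigOr. exists F. split; [assumption |].
      apply in_map_iff in HF. destruct HF as [F' [<- _]].
      now apply preduct_neg.
    + destruct (existsb _ _); [| destruct HB].
      apply preduct_neg. simpl. tauto.
Qed.

(** The premise [I (asym h, r)] unites the two kinds of head: for a basic rule it follows from [HG],
    and for a choice rule its failure makes the disjunct [PNeg] true. For a constraint both sides
    hold, since [HG] falsifies the body in [I]. *)
Lemma preduct_rule (I I' : Ensemble patom) (G : rule)
  (HI' : Included patom I' I) (HG : psat I (tau_rule lt G)) :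
  psat I' (preduct I (tau_rule lt G)) <->
  forall h r, head_lit G = Some h -> List.In r (vals_tuple (aargs h)) ->
    psat I (tau_body lt (body G)) -> pos_supported I' G ->
    I (asym h, r) -> I' (asym h, r).
Proof.
  unfold tau_rule, head_lit in *. destruct (Defs.head G) as [h | h |].
  - rewrite preduct_imp, preduct_body, preduct_PBigAnd by assumption. split.
    + intros [_ H] h' r [= <-] Hr HB HP _.
      assert (H1 := H (conj HB HP) _ (in_map (fun r => PAtom (asym h, r)) _ _ Hr)).
      apply preduct_atom in H1. tauto.
    + intros H. split; [exact HG |]. intros [HB HP] F HF.
      assert (HF1 := proj1 (psat_PBigAnd _ _) (HG HB) F HF).
      apply in_map_iff in HF. destruct HF as [r [<- Hr]].
      apply preduct_atom. split; [exact HF1 |]. now apply H.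
  - rewrite preduct_imp, preduct_body, preduct_PBigAnd by assumption. split.
    + intros [_ H] h' r [= <-] Hr HB HP Ir.
      assert (H1 := H (conj HB HP) _ (in_map (fun F => POr F (PNeg F)) _ _
                (in_map (fun r => PAtom (asym h, r)) _ _ Hr))).
      apply preduct_or in H1.
      rewrite preduct_atom, preduct_neg in H1. simpl in H1. tauto.
    + intros H. split; [exact HG |]. intros [HB HP] F HF.
      apply in_map_iff in HF. destruct HF as [F' [<- HF]].
      apply in_map_iff in HF. destruct HF as [r [<- Hr]].
      rewrite preduct_or, preduct_atom, preduct_neg. simpl.
      destruct (classic (I (asym h, r))) as [Ir | Ir]; [left | now right].
      split; [exact Ir |]. now apply H.
  - split; [intros _ h r [=] |].
    intros _. now apply preduct_neg.
Qed.

Lemma stable_model_iff (Pi : program) (I : Ensemble patom) :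
  stable_model lt Pi I <->
  (forall F, tau lt Pi F -> psat I F) /\
  (forall I', Included patom I' I ->
     (forall pa, I pa -> supported lt Pi I I' pa -> I' pa) ->
     Included patom I I').
Proof.
  unfold stable_model.
  assert (Hself : reduct_model lt Pi I I <-> forall F, tau lt Pi F -> psat I F).
  { unfold reduct_model. split; intros H F HF; apply preduct_self; auto. }
  rewrite Hself.
  assert (Hred : (forall F, tau lt Pi F -> psat I F) ->
    forall I', Included patom I' I ->
    (reduct_model lt Pi I I' <->
     (forall pa, I pa -> supported lt Pi I I' pa -> I' pa))).
  { intros Hm I' HI'. split.
    - intros H [p r] Ia (R & s & h & HR & Hh & Hp & Hr & HB & HP).
      simpl in Hp, Hr. subst p.
      assert (HF : tau lt Pi (tau_rule lt (inst_rule s R))) by (exists R, s; auto).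
      exact (proj1 (preduct_rule _ _ _ HI' (Hm _ HF)) (H _ HF) h r Hh Hr HB HP Ia).
    - intros H F HF. assert (HG := Hm F HF).
      destruct HF as (R & s & HR & ->).
      apply preduct_rule; auto.
      intros h r Hh Hr HB HP Ir. apply H; [assumption |].
      exists R, s, h. simpl; auto 10. }
  split; intros [Hm H]; (split; [exact Hm |]); intros I' HI' Hc.
  - apply H; auto. now apply Hred.
  - split; [assumption |]. apply H; auto. now apply Hred.
Qed.

End StableModels.

(** * Values of ground terms *)

(** The two bounds say that [c] is the quotient of the absolute values; rounding toward zero
    commutes with sign changes, so the sign of [a * b] recovers [Z.quot a b]. A zero [b] would turn
    the second bound into [Z.abs a < 0]. *)
Lemma quot_characterization (a b c : Z) :
  (c * Z.abs b <= Z.abs a)%Z -> (Z.abs a < (c + 1) * Z.abs b)%Z ->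
  b <> 0%Z /\ ((a * b >= 0)%Z -> Z.quot a b = c) /\
  ((a * b < 0)%Z -> Z.quot a b = (0 - c)%Z).
Proof.
  intros H1 H2. assert (Hb : b <> 0%Z) by (intros ->; simpl in *; lia).
  split; [exact Hb |].
  assert (Hc : Z.quot (Z.abs a) (Z.abs b) = c).
  { symmetry. apply Z.quot_unique with (Z.abs a - Z.abs b * c)%Z; lia. }
  (* For nonzero [a] the equations [Ea] and [Eb] determine the sign of [a * b], and one of the two
     claims becomes vacuous. The value [a = 0], compatible with both forms of [Ea], is treated
     apart. *)
  destruct (Z.abs_eq_or_opp a) as [Ea | Ea], (Z.abs_eq_or_opp b) as [Eb | Eb];
    rewrite Ea, Eb in Hc;
    rewrite ?Z.quot_opp_opp, ?Z.quot_opp_l, ?Z.quot_opp_r in Hc by assumption;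
    (destruct (Z.eq_dec a 0) as [-> | Ha];
     [rewrite Z.quot_0_l in * by assumption; lia | split; intros; nia]).
Qed.

Lemma quot_abs_bounds (a b : Z) :
  b <> 0%Z ->
  (Z.quot (Z.abs a) (Z.abs b) * Z.abs b <= Z.abs a)%Z /\
  (Z.abs a < (Z.quot (Z.abs a) (Z.abs b) + 1) * Z.abs b)%Z.
Proof.
  intros Hb. pose proof (Z.quot_rem' (Z.abs a) (Z.abs b)).
  pose proof (Z.rem_bound_pos (Z.abs a) (Z.abs b)). lia.
Qed.

Lemma in_nums (l : list precomp) (n : Z) :
  List.In n (nums l) <-> List.In (Num n) l.
Proof.
  unfold nums. rewrite in_flat_map. split.
  - intros [c [Hc Hn]]. destruct c; simpl in Hn; try tauto.
    destruct Hn as [<- | []]; assumption.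
  - intros H. exists (Num n). simpl. auto.
Qed.

Lemma in_num_pairs (l1 l2 : list precomp) (a b : Z) :
  List.In (a, b) (num_pairs l1 l2) <-> List.In (Num a) l1 /\ List.In (Num b) l2.
Proof. unfold num_pairs. now rewrite in_prod_iff, !in_nums. Qed.

Lemma in_zinterval (m n k : Z) :
  List.In k (zinterval m n) <-> (m <= k <= n)%Z.
Proof.
  unfold zinterval. rewrite in_map_iff. split.
  - intros [i [<- Hi]]. apply in_seq in Hi. lia.
  - intros H. exists (Z.to_nat (k - m)). rewrite in_seq. lia.
Qed.

Lemma in_vals_abs (t : pterm) (c : precomp) :
  List.In c (vals (TAbs t)) <->
  exists n, List.In (Num n) (vals t) /\ c = Num (Z.abs n).
Proof.
  simpl. rewrite in_map_iff. split.
  - intros [n [<- Hn]]. apply in_nums in Hn. eauto.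
  - intros [n [Hn ->]]. exists n. now rewrite in_nums.
Qed.

Lemma in_vals_arith (o : arith_op) (t1 t2 : pterm) (c : precomp) :
  List.In c (vals (TArith o t1 t2)) <->
  exists m n, List.In (Num m) (vals t1) /\ List.In (Num n) (vals t2) /\
    c = Num (arith_fun o m n).
Proof.
  simpl. rewrite in_map_iff. split.
  - intros [[m n] [<- H]]. apply in_num_pairs in H. exists m, n. tauto.
  - intros (m & n & Hm & Hn & ->). exists (m, n). now rewrite in_num_pairs.
Qed.

Lemma in_nonzero_pairs (t1 t2 : pterm) (m n : Z) :
  List.In (m, n) (filter nonzero_divisor (num_pairs (vals t1) (vals t2))) <->
  List.In (Num m) (vals t1) /\ List.In (Num n) (vals t2) /\ n <> 0%Z.
Proof.
  rewrite filter_In, in_num_pairs. unfold nonzero_divisor. simpl.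
  rewrite negb_true_iff, Z.eqb_neq. tauto.
Qed.

Lemma in_vals_div (t1 t2 : pterm) (c : precomp) :
  List.In c (vals (TDiv t1 t2)) <->
  exists m n, List.In (Num m) (vals t1) /\ List.In (Num n) (vals t2) /\
    n <> 0%Z /\ c = Num (Z.quot m n).
Proof.
  simpl. rewrite in_map_iff. split.
  - intros [[m n] [<- H]]. apply in_nonzero_pairs in H. exists m, n. tauto.
  - intros (m & n & Hm & Hn & H0 & ->). exists (m, n).
    now rewrite in_nonzero_pairs.
Qed.

Lemma in_vals_mod (t1 t2 : pterm) (c : precomp) :
  List.In c (vals (TMod t1 t2)) <->
  exists m n, List.In (Num m) (vals t1) /\ List.In (Num n) (vals t2) /\
    n <> 0%Z /\ c = Num (m - n * Z.quot m n).
Proof.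
  simpl. rewrite in_map_iff. split.
  - intros [[m n] [<- H]]. apply in_nonzero_pairs in H. exists m, n. tauto.
  - intros (m & n & Hm & Hn & H0 & ->). exists (m, n).
    now rewrite in_nonzero_pairs.
Qed.

Lemma in_vals_interval (t1 t2 : pterm) (c : precomp) :
  List.In c (vals (TInterval t1 t2)) <->
  exists m n k, List.In (Num m) (vals t1) /\ List.In (Num n) (vals t2) /\
    (m <= k)%Z /\ (k <= n)%Z /\ c = Num k.
Proof.
  simpl. rewrite in_map_iff. split.
  - intros [k [<- H]]. apply in_flat_map in H. destruct H as [[m n] [H Hk]].
    apply in_num_pairs in H. apply in_zinterval in Hk. simpl in Hk.
    exists m, n, k. tauto.
  - intros (m & n & k & Hm & Hn & H1 & H2 & ->). exists k.
    split; [reflexivity |]. apply in_flat_map. exists (m, n).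
    rewrite in_num_pairs, in_zinterval. auto.
Qed.

Lemma in_vals_tuple_cons (t : pterm) (ts : list pterm) (c : precomp)
  (r : list precomp) :
  List.In (c :: r) (vals_tuple (t :: ts)) <->
  List.In c (vals t) /\ List.In r (vals_tuple ts).
Proof.
  simpl. rewrite in_flat_map. split.
  - intros [d [Hd H]]. apply in_map_iff in H. destruct H as [r' [[= -> ->] H]].
    auto.
  - intros [Hc Hr]. exists c. split; [assumption | now apply in_map].
Qed.

Lemma vals_tuple_length (ts : list pterm) (r : list precomp) :
  List.In r (vals_tuple ts) -> length r = length ts.
Proof.
  revert r. induction ts as [|t ts IH]; simpl; intros r H.
  - destruct H as [<- | []]; reflexivity.
  - apply in_flat_map in H. destruct H as [c [_ H]].
    apply in_map_iff in H. destruct H as [r' [<- H]]. simpl. f_equal. auto.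
Qed.

(** * Program variables of terms *)

Fixpoint term_pvars (t : pterm) : list pvar :=
  match t with
  | TConst _ => []
  | TVar x => [x]
  | TAbs t1 => term_pvars t1
  | TArith _ t1 t2 | TDiv t1 t2 | TMod t1 t2 | TInterval t1 t2 =>
      term_pvars t1 ++ term_pvars t2
  end.

Lemma term_pvars_bound (t : pterm) (x : pvar) :
  List.In x (term_pvars t) -> x < term_bound t.
Proof.
  induction t; simpl; rewrite ?in_app_iff; intuition lia.
Qed.

Lemma term_bound_le (ts : list pterm) (t : pterm) :
  List.In t ts -> term_bound t <= terms_bound ts.
Proof.
  intros H. apply (in_map term_bound) in H. unfold terms_bound.
  exact (proj1 (Forall_forall _ _) (proj1 (list_max_le _ _) (le_n _)) _ H).
Qed.

Lemma inst_term_ext (s s' : pvar -> precomp) (t : pterm) :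
  (forall x, List.In x (term_pvars t) -> s x = s' x) ->
  inst_term s t = inst_term s' t.
Proof.
  induction t; simpl; intros H; f_equal; auto;
    match goal with IH : _ -> ?G |- ?G => apply IH end;
    intros x Hx; apply H, in_app_iff; auto.
Qed.

(** The form in which freshness is used: changing a substitution at indices from [m] on does not
    affect terms bounded by [m]. *)
Lemma inst_terms_ext (s s' : pvar -> precomp) (ts : list pterm) (m : nat) :
  terms_bound ts <= m -> (forall x, x < m -> s x = s' x) ->
  map (inst_term s) ts = map (inst_term s') ts.
Proof.
  intros Hm H. apply map_ext_in. intros t Ht. apply inst_term_ext.
  intros x Hx. apply H. apply term_pvars_bound in Hx.
  apply term_bound_le in Ht. lia.
Qed.

(** * Variables of rules *)

Lemma in_pvars_from (m n : nat) (x : var) :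
  List.In x (pvars_from m n) <-> exists v, x = PV v /\ m <= v < m + n.
Proof.
  unfold pvars_from. rewrite in_map_iff. split.
  - intros [v [<- Hv]]. apply in_seq in Hv. eauto.
  - intros [v [-> Hv]]. exists v. now rewrite in_seq.
Qed.

Lemma length_pvars_from (m n : nat) : length (pvars_from m n) = n.
Proof. unfold pvars_from. now rewrite length_map, length_seq. Qed.

Lemma in_remove_vars (xs ys : list var) (y : var) :
  List.In y (remove_vars xs ys) <-> List.In y ys /\ ~ List.In y xs.
Proof.
  unfold remove_vars. rewrite filter_In.
  destruct (in_dec var_eq_dec y xs); intuition congruence.
Qed.

Lemma in_free_occs_FExs (xs : list var) (F : form) (x : var) :
  List.In x (free_occs (FExs xs F)) <-> List.In x (free_occs F) /\ ~ List.In x xs.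
Proof.
  induction xs as [|y xs IH]; [simpl; tauto |].
  change (free_occs (FExs (y :: xs) F))
    with (remove_vars [y] (free_occs (FExs xs F))).
  rewrite in_remove_vars, IH. simpl. tauto.
Qed.

Lemma in_free_occs_FBigAnd (l : list form) (F : form) (x : var) :
  List.In F l -> List.In x (free_occs F) -> List.In x (free_occs (FBigAnd l)).
Proof.
  induction l as [|G l IH]; simpl; [tauto |].
  intros [<- | HF] Hx; apply in_app_iff; auto.
Qed.

(** The quantifiers of [val] bind integer variables only, so they cannot capture a program variable
    of [t]. *)
Lemma free_occs_val (t : pterm) (V : var) (x : pvar) :
  List.In x (term_pvars t) -> List.In (PV x) (free_occs (val t V)).
Proof.
  assert (HIV : forall is, ~ List.In (PV x) (map IV is)).
  { intros is H. apply in_map_iff in H. destruct H as [i [[=] _]]. }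
  revert V. induction t as [c | y | t1 IH1 | o t1 IH1 t2 IH2 | t1 IH1 t2 IH2
    | t1 IH1 t2 IH2 | t1 IH1 t2 IH2]; intros V H; set (i := fresh_ivar V).
  - destruct H.
  - destruct H as [<- | []]. simpl. apply in_app_iff. right. now left.
  - apply (in_free_occs_FExs [IV i]). split; [| apply (HIV [i])].
    cbn [free_occs]. apply in_app_iff. left. now apply IH1.
  - apply in_free_occs_FExs. split; [| apply (HIV [i; S i])].
    cbn [free_occs]. rewrite !in_app_iff.
    apply in_app_iff in H. destruct H; auto.
  - apply in_free_occs_FExs. split; [| apply (HIV [i; S i; S (S i)])].
    cbn [free_occs]. rewrite !in_app_iff.
    apply in_app_iff in H. destruct H; auto.
  - apply in_free_occs_FExs. split; [| apply (HIV [i; S i; S (S i)])].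
    cbn [free_occs]. rewrite !in_app_iff.
    apply in_app_iff in H. destruct H; auto.
  - apply in_free_occs_FExs. split; [| apply (HIV [i; S i; S (S i)])].
    cbn [free_occs]. rewrite !in_app_iff.
    apply in_app_iff in H. destruct H; auto.
Qed.

Lemma in_combine_fst {A B : Type} (l : list A) (l' : list B) (a : A) :
  length l = length l' -> List.In a l -> exists b, List.In (a, b) (combine l l').
Proof.
  revert l'. induction l as [|c l IH]; intros [|b l'] H Ha;
    try discriminate H; [destruct Ha |].
  destruct Ha as [-> | Ha].
  - exists b. now left.
  - destruct (IH l') as [b' Hb]; [now injection H | assumption |].
    exists b'. now right.
Qed.

Lemma free_occs_val_tuple (ts : list pterm) (Vs : list var) (t : pterm) (x : pvar) :
  length ts = length Vs -> List.In t ts -> List.In x (term_pvars t) ->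
  List.In (PV x) (free_occs (val_tuple ts Vs)).
Proof.
  intros Hl Ht Hx. destruct (in_combine_fst ts Vs t Hl Ht) as [V HV].
  apply in_free_occs_FBigAnd with (val t V).
  - exact (in_map (fun tV => val (fst tV) (snd tV)) _ _ HV).
  - now apply free_occs_val.
Qed.

(** The variables bound by [tauB_body_elt] start at [terms_bound], above every variable of the
    literal. *)
Lemma free_occs_tauB_body_elt (b : body_elt) (t : pterm) (x : pvar) :
  List.In t (body_elt_terms b) -> List.In x (term_pvars t) ->
  List.In (PV x) (free_occs (tauB_body_elt b)).
Proof.
  intros Ht Hx.
  assert (Hb : forall ts n, List.In t ts ->
    ~ List.In (PV x) (pvars_from (terms_bound ts) n)).
  { intros ts n Hts. rewrite in_pvars_from. intros [v [[= <-] Hv]].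
    apply term_pvars_bound in Hx. apply term_bound_le in Hts. lia. }
  assert (Ha : forall a f, List.In t (aargs a) ->
    List.In (PV x) (free_occs (tauB_atom a f))).
  { intros a f Hta. apply in_free_occs_FExs. split; [| now apply Hb].
    cbn [free_occs]. apply in_app_iff. left.
    apply free_occs_val_tuple with t; auto. now rewrite length_pvars_from. }
  destruct b as [a | a | a | o t1 t2]; simpl in Ht; try (now apply Ha).
  apply in_free_occs_FExs. split; [| now apply (Hb [t1; t2] 2)].
  cbn [free_occs]. rewrite !in_app_iff.
  destruct Ht as [-> | [-> | []]]; [left | right; left]; now apply free_occs_val.
Qed.

(** Guarantees that the quantifier over [other_free_vars] reaches every variable of the rule, so
    that any instance can be selected by its witnesses. The length condition prevents [combine] from
    dropping head arguments. *)
Lemma free_occs_Form (R : rule) (h : atom) (X : list var) (t : pterm) (x : pvar) :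
  head_lit R = Some h -> length (aargs h) = length X ->
  List.In t (rule_terms R) -> List.In x (term_pvars t) ->
  List.In (PV x) (free_occs (Form R X)).
Proof.
  unfold rule_terms. intros Hh HX Ht Hx. rewrite Hh in Ht.
  assert (H : List.In (PV x)
    (free_occs (FAnd (val_tuple (aargs h) X) (tauB_body (body R))))).
  { cbn [free_occs]. apply in_app_iff. apply in_app_iff in Ht.
    destruct Ht as [Ht | Ht]; [left | right].
    - now apply free_occs_val_tuple with t.
    - apply in_flat_map in Ht. destruct Ht as [b [Hb Ht]].
      apply in_free_occs_FBigAnd with (tauB_body_elt b); [now apply in_map |].
      now apply free_occs_tauB_body_elt with t. }
  unfold head_lit in Hh. unfold Form.
  destruct (Defs.head R); inversion Hh; subst; [exact H |].
  cbn [free_occs] in *. apply in_app_iff. now left.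
Qed.

Lemma inst_rule_ext (s s' : pvar -> precomp) (R : rule) :
  (forall t x, List.In t (rule_terms R) -> List.In x (term_pvars t) -> s x = s' x) ->
  inst_rule s R = inst_rule s' R.
Proof.
  intros H.
  assert (Ht : forall t, List.In t (rule_terms R) -> inst_term s t = inst_term s' t).
  { intros t Ht. apply inst_term_ext. intros x. now apply H. }
  clear H. destruct R as [hd bd]. unfold rule_terms, head_lit in Ht. simpl in Ht.
  assert (Ha : forall a, (forall t, List.In t (aargs a) ->
    inst_term s t = inst_term s' t) -> inst_atom s a = inst_atom s' a).
  { intros a Ha. unfold inst_atom. f_equal. now apply map_ext_in. }
  unfold inst_rule. simpl. f_equal.
  - destruct hd; simpl; [| | reflexivity];
      f_equal; apply Ha; intros t H; apply Ht, in_app_iff; auto.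
  - apply map_ext_in. intros b Hb.
    assert (Hbt : forall t, List.In t (body_elt_terms b) ->
      inst_term s t = inst_term s' t).
    { intros t H. apply Ht, in_app_iff. right. apply in_flat_map. eauto. }
    destruct b; simpl in *; f_equal; auto.
Qed.

Lemma head_lit_inst (s : pvar -> precomp) (R : rule) :
  head_lit (inst_rule s R) = option_map (inst_atom s) (head_lit R).
Proof. unfold head_lit. simpl. now destruct (Defs.head R). Qed.

Lemma body_pos_inst (s : pvar -> precomp) (R : rule) :
  body_pos (inst_rule s R) = map (inst_atom s) (body_pos R).
Proof.
  unfold body_pos. simpl. induction (body R) as [|b B IH]; [reflexivity |].
  destruct b; simpl; now rewrite IH.
Qed.

Lemma program_bound_spec (Pi : program) (R : rule) (t : pterm) :
  List.In R (rules Pi) -> List.In t (rule_terms R) ->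
  term_bound t <= program_bound Pi.
Proof.
  intros HR Ht. apply term_bound_le, in_flat_map. eauto.
Qed.

Lemma body_pos_bound (Pi : program) (R : rule) (a : atom) :
  List.In R (rules Pi) -> List.In a (body_pos R) ->
  terms_bound (aargs a) <= program_bound Pi.
Proof.
  intros HR Ha. apply list_max_le, Forall_forall. intros n Hn.
  apply in_map_iff in Hn. destruct Hn as [t [<- Ht]].
  apply program_bound_spec with R; [assumption |].
  apply in_app_iff. right. apply in_flat_map. exists (Pos a).
  split; [now apply in_body_pos | assumption].
Qed.

Lemma in_rules_for (Pi : program) (p : pred) (R : rule) :
  List.In R (rules_for Pi p) <->
  List.In R (rules Pi) /\ exists h, head_lit R = Some h /\ atom_pred h = p.
Proof.
  unfold rules_for. rewrite filter_In. destruct (head_lit R) as [h |].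
  - destruct (pred_eq_dec (atom_pred h) p) as [E | E]; split.
    + intros [HR _]. eauto.
    + tauto.
    + intros [_ [=]].
    + intros [_ [h' [[= <-] E']]]. contradiction.
  - split; [intros [_ [=]] | intros [_ [h [[=] _]]]].
Qed.

Lemma head_pred_in_preds (Pi : program) (R : rule) (h : atom) :
  List.In R (rules Pi) -> head_lit R = Some h ->
  List.In (atom_pred h) (preds Pi).
Proof.
  intros HR Hh. apply nodup_In, in_map, in_flat_map. exists R.
  split; [assumption |]. unfold rule_atoms. rewrite Hh. now left.
Qed.

(** * Satisfaction in extensions of standard interpretations *)

Section Standard.
Variable lt : precomp -> precomp -> bool.
Variable I : Ensemble patom.
Variable prec : symbol -> symbol -> list precomp -> list precomp -> Prop.

Let M : interp0 := std_interp lt I.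
Let J : interp := Interp M prec.

(** The semantics of a quantifier block as a relation between assignments, insensitive to order and
    repetitions in [xs]. *)
Definition agree_outside (xs : list var) (e e' : assignment M) : Prop :=
  (forall v, ~ List.In (PV v) xs -> a_gen e' v = a_gen e v) /\
  (forall n, ~ List.In (IV n) xs -> a_int e' n = a_int e n).

Lemma agree_outside_refl (xs : list var) (e : assignment M) :
  agree_outside xs e e.
Proof. split; auto. Qed.

(** Functional extensionality turns pointwise agreement into equality, so that assignments can be
    rewritten inside [sat] without a separate congruence lemma. *)
Lemma agree_outside_nil (e e' : assignment M) : agree_outside [] e e' -> e' = e.
Proof.
  destruct e as [g i], e' as [g' i']. intros [Hg Hi]. simpl in *.
  f_equal; apply functional_extensionality; auto.
Qed.

Definition get_var (e : assignment M) (x : var) : precomp :=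
  eval_gterm e (var_term x).

Lemma agree_outside_get (xs : list var) (e e' : assignment M) (x : var) :
  agree_outside xs e e' -> ~ List.In x xs -> get_var e' x = get_var e x.
Proof.
  intros [Hg Hi] Hx. destruct x; unfold get_var; simpl; [| f_equal]; auto.
Qed.

Lemma agree_outside_cons_gen (x : pvar) (xs : list var) (e e' : assignment M) :
  agree_outside (PV x :: xs) e e' <->
  exists d : gdom M, agree_outside xs (set_gen e x d) e'.
Proof.
  split.
  - intros [Hg Hi]. exists (a_gen e' x). split; simpl.
    + intros v Hv. destruct (Nat.eq_dec v x) as [-> | Hn]; [reflexivity |].
      apply Hg. simpl. intros [[= ->] | H]; auto.
    + intros n Hn. apply Hi. simpl. intros [[=] | H]; auto.
  - intros [d [Hg Hi]]. split; simpl in *.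
    + intros v Hv. rewrite Hg by tauto.
      destruct (Nat.eq_dec v x) as [-> | Hn]; [tauto | reflexivity].
    + intros n Hn. apply Hi. tauto.
Qed.

Lemma agree_outside_cons_int (x : ivar) (xs : list var) (e e' : assignment M) :
  agree_outside (IV x :: xs) e e' <->
  exists d : idom M, agree_outside xs (set_int e x d) e'.
Proof.
  split.
  - intros [Hg Hi]. exists (a_int e' x). split; simpl.
    + intros n Hn. apply Hg. simpl. intros [[=] | H]; auto.
    + intros v Hv. destruct (Nat.eq_dec v x) as [-> | Hn]; [reflexivity |].
      apply Hi. simpl. intros [[= ->] | H]; auto.
  - intros [d [Hg Hi]]. split; simpl in *.
    + intros n Hn. apply Hg. tauto.
    + intros v Hv. rewrite Hi by tauto.
      destruct (Nat.eq_dec v x) as [-> | Hn]; [tauto | reflexivity].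
Qed.

Lemma sat_FExs (xs : list var) (F : form) (e : assignment M) :
  sat J e (FExs xs F) <-> exists e', agree_outside xs e e' /\ sat J e' F.
Proof.
  revert e. induction xs as [|x xs IH]; intros e.
  - simpl. split.
    + intros H. exists e. split; [apply agree_outside_refl | exact H].
    + intros [e' [He H]]. now rewrite <- (agree_outside_nil _ _ He).
  - change (FExs (x :: xs) F) with (FEx x (FExs xs F)).
    destruct x as [x | x]; simpl sat.
    + split.
      * intros [d H]. apply IH in H. destruct H as [e' [He H]].
        exists e'. split; [| exact H]. apply agree_outside_cons_gen. now exists d.
      * intros [e' [He H]]. apply agree_outside_cons_gen in He.
        destruct He as [d He]. exists d. apply IH. now exists e'.
    + split.
      * intros [d H]. apply IH in H. destruct H as [e' [He H]].
        exists e'. split; [| exact H]. apply agree_outside_cons_int. now exists d.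
      * intros [e' [He H]]. apply agree_outside_cons_int in He.
        destruct He as [d He]. exists d. apply IH. now exists e'.
Qed.

(** [is_model] already ranges over all assignments. To remove a quantifier, its variable is
    instantiated with its own current value, which leaves the assignment unchanged. *)
Lemma is_model_FAlls (xs : list var) (F : form) :
  is_model J (FAlls xs F) <-> is_model J F.
Proof.
  induction xs as [|x xs IH]; [reflexivity |].
  rewrite <- IH. change (FAlls (x :: xs) F) with (FAll x (FAlls xs F)).
  split; intros H e.
  - specialize (H e). destruct x as [x | x]; simpl in H.
    + specialize (H (a_gen e x)).
      rewrite (agree_outside_nil (set_gen e x (a_gen e x)) e); [exact H |].
      split; intros v _; simpl; [destruct (Nat.eq_dec v x) as [-> |] |]; reflexivity.
    + specialize (H (a_int e x)).
      rewrite (agree_outside_nil (set_int e x (a_int e x)) e); [exact H |].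
      split; intros v _; simpl; [| destruct (Nat.eq_dec v x) as [-> |]]; reflexivity.
  - destruct x; simpl; intros d; apply H.
Qed.

Lemma sat_FBigAnd (l : list form) (e : assignment M) :
  sat J e (FBigAnd l) <-> forall F, List.In F l -> sat J e F.
Proof.
  induction l as [|G l IH]; simpl.
  - split; [intros _ F [] | tauto].
  - change (fold_right FAnd FTop l) with (FBigAnd l). rewrite IH. split.
    + intros [HG Hl] F [<- | HF]; auto.
    + intros H. split; auto.
Qed.

Lemma sat_FBigOr (l : list form) (e : assignment M) :
  sat J e (FBigOr l) <-> exists F, List.In F l /\ sat J e F.
Proof.
  induction l as [|G l IH]; simpl.
  - split; [intros [] | intros [F [[] _]]].
  - change (fold_right FOr FBot l) with (FBigOr l). rewrite IH. split.
    + intros [HG | [F [HF HS]]]; eauto.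
    + intros [F [[<- | HF] HS]]; eauto.
Qed.

Lemma is_model_FBigAnd_map {A : Type} (f : A -> form) (l : list A) :
  is_model J (FBigAnd (map f l)) <-> forall a, List.In a l -> is_model J (f a).
Proof.
  split.
  - intros H a Ha e. exact (proj1 (sat_FBigAnd _ _) (H e) _ (in_map f _ _ Ha)).
  - intros H e. apply sat_FBigAnd. intros F HF.
    apply in_map_iff in HF. destruct HF as [a [<- Ha]]. now apply H.
Qed.

Lemma is_model_FAnd (F G : form) :
  is_model J (FAnd F G) <-> is_model J F /\ is_model J G.
Proof.
  split; [intros H; split; intros e; apply (H e) | intros [HF HG] e; split; auto].
Qed.

(** * Correctness of the formulas [val] *)

Hypothesis Hlt : precomp_order lt.

Lemma cmpb_eq (c d : precomp) : cmpb lt CEq c d = true <-> c = d.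
Proof.
  unfold cmpb. destruct (precomp_eq_dec c d); split; congruence.
Qed.

Lemma cmpb_lt_num (a b : Z) : cmpb lt CLt (Num a) (Num b) = true <-> (a < b)%Z.
Proof. apply (lt_num _ Hlt). Qed.

Lemma cmpb_le_num (a b : Z) : cmpb lt CLe (Num a) (Num b) = true <-> (a <= b)%Z.
Proof.
  unfold cmpb. rewrite orb_true_iff, (lt_num _ Hlt).
  destruct (precomp_eq_dec (Num a) (Num b)) as [[= ->] | H].
  - intuition lia.
  - assert (a <> b) by congruence. split; [intros [|]; [lia | congruence] | lia].
Qed.

Lemma cmpb_ge_num (a b : Z) : cmpb lt CGe (Num a) (Num b) = true <-> (a >= b)%Z.
Proof.
  unfold cmpb. rewrite orb_true_iff, (lt_num _ Hlt).
  destruct (precomp_eq_dec (Num a) (Num b)) as [[= ->] | H].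
  - intuition lia.
  - assert (a <> b) by congruence. split; [intros [|]; [lia | congruence] | lia].
Qed.

Lemma a_int_set_same (e : assignment M) (n : ivar) (d : idom M) :
  a_int (set_int e n d) n = d.
Proof. simpl. now destruct (Nat.eq_dec n n). Qed.

Lemma a_int_set_other (e : assignment M) (m n : ivar) (d : idom M) :
  m <> n -> a_int (set_int e n d) m = a_int e m.
Proof. intros H. simpl. now destruct (Nat.eq_dec m n). Qed.

Lemma get_var_set_fresh (e : assignment M) (V : var) (n : ivar) (d : idom M) :
  fresh_ivar V <= n -> get_var (set_int e n d) V = get_var e V.
Proof.
  destruct V as [x | m]; [reflexivity |]. intros H. unfold get_var.
  cbn [var_term eval_gterm eval_iterm]. f_equal. apply a_int_set_other.
  simpl in H. lia.
Qed.

Lemma get_var_set_same (e : assignment M) (n : ivar) (d : idom M) :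
  get_var (set_int e n d) (IV n) = Num d.
Proof.
  unfold get_var. cbn [var_term eval_gterm eval_iterm].
  now rewrite a_int_set_same.
Qed.

Lemma sat_FEqV (e : assignment M) (V : var) (t : iterm) :
  sat J e (FEqV V t) <-> get_var e V = Num (eval_iterm e t).
Proof. apply cmpb_eq. Qed.

(** Quantified over [V] and [e] because the induction meets subterms at integer variables and under
    updated assignments. Such updates leave [a_gen e], hence the ground instance, unchanged. *)
Definition val_correct (t : pterm) : Prop :=
  forall (V : var) (e : assignment M),
  sat J e (val t V) <-> List.In (get_var e V) (vals (inst_term (a_gen e) t)).

Definition set_int3 (e : assignment M) (i : ivar) (a b c : idom M) :
  assignment M :=
  set_int (set_int (set_int e i a) (S i) b) (S (S i)) c.

(** The outer update at [S i] does not disturb the value at [i], so each subterm is read at its own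
    variable. *)
Lemma sat_val_pair (t1 t2 : pterm) (e : assignment M) (i : ivar) (a b : idom M)
  (F : form) :
  val_correct t1 -> val_correct t2 ->
  sat J (set_int (set_int e i a) (S i) b)
    (FAnd (val t1 (IV i)) (FAnd (val t2 (IV (S i))) F)) <->
  List.In (Num a) (vals (inst_term (a_gen e) t1)) /\
  List.In (Num b) (vals (inst_term (a_gen e) t2)) /\
  sat J (set_int (set_int e i a) (S i) b) F.
Proof.
  intros H1 H2. cbn [sat]. rewrite (H1 (IV i)), (H2 (IV (S i))).
  rewrite get_var_set_same, get_var_set_fresh, get_var_set_same by (simpl; lia).
  reflexivity.
Qed.

Lemma sat_val_triple (t1 t2 : pterm) (e : assignment M) (i : ivar)
  (a b c : idom M) (F : form) :
  val_correct t1 -> val_correct t2 ->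
  sat J (set_int3 e i a b c)
    (FAnd (val t1 (IV i)) (FAnd (val t2 (IV (S i))) F)) <->
  List.In (Num a) (vals (inst_term (a_gen e) t1)) /\
  List.In (Num b) (vals (inst_term (a_gen e) t2)) /\
  sat J (set_int3 e i a b c) F.
Proof.
  intros H1 H2. cbn [sat]. rewrite (H1 (IV i)), (H2 (IV (S i))).
  unfold set_int3.
  rewrite !(get_var_set_fresh _ _ (S (S i))) by (simpl; lia).
  rewrite get_var_set_same, get_var_set_fresh, get_var_set_same by (simpl; lia).
  reflexivity.
Qed.

Lemma set_int3_vars (e : assignment M) (V : var) (a b c : idom M) :
  let i := fresh_ivar V in
  let e' := set_int3 e i a b c in
  get_var e' V = get_var e V /\
  a_int e' i = a /\ a_int e' (S i) = b /\ a_int e' (S (S i)) = c.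
Proof.
  cbv zeta. unfold set_int3.
  rewrite !get_var_set_fresh, a_int_set_same by lia.
  rewrite !(a_int_set_other _ _ (S (S _))), a_int_set_same by lia.
  rewrite a_int_set_other, a_int_set_same by lia. auto.
Qed.

Lemma sat_val_div_matrix (e : assignment M) (V : var) (a b c : idom M)
  (r1 r2 : iterm) :
  let i := fresh_ivar V in
  let e' := set_int3 e i a b c in
  sat J e' (val_div_matrix V (IVar i) (IVar (S i)) (IVar (S (S i))) r1 r2) <->
  (c * Z.abs b <= Z.abs a)%Z /\ (Z.abs a < (c + 1) * Z.abs b)%Z /\
  ((a * b >= 0)%Z /\ get_var e V = Num (eval_iterm e' r1) \/
   (a * b < 0)%Z /\ get_var e V = Num (eval_iterm e' r2)).
Proof.
  cbv zeta. destruct (set_int3_vars e V a b c) as (HV & Ha & Hb & Hc).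
  set (e' := set_int3 _ _ _ _ _) in *.
  unfold val_div_matrix. cbn [sat]. rewrite !sat_FEqV, HV.
  cbn [eval_gterm eval_iterm]. change (reduct0 J) with M. rewrite Ha, Hb, Hc.
  cbn [reduct0 J M std_interp i_cmp i_arith i_abs i_num Defs.incl arith_fun].
  now rewrite cmpb_le_num, !cmpb_lt_num, cmpb_ge_num.
Qed.

Lemma sat_val (t : pterm) : val_correct t.
Proof.
  induction t as [c | x | t1 IH1 | o t1 IH1 t2 IH2 | t1 IH1 t2 IH2
    | t1 IH1 t2 IH2 | t1 IH1 t2 IH2]; intros V e; set (i := fresh_ivar V).
  - cbn [val sat]. simpl (i_cmp _). rewrite cmpb_eq.
    change (get_var e V = eval_gterm e (const_term c) <->
      List.In (get_var e V) [c]).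
    replace (eval_gterm e (const_term c)) with c by now destruct c.
    simpl. intuition congruence.
  - cbn [val sat]. simpl (i_cmp _). rewrite cmpb_eq.
    change (get_var e V = a_gen e x <-> List.In (get_var e V) [a_gen e x]).
    simpl. intuition congruence.
  - cbn [inst_term]. rewrite in_vals_abs. cbn [val sat]. fold i.
    split; intros [a [H1 H2]]; exists a.
    + apply IH1 in H1. rewrite get_var_set_same in H1. split; [exact H1 |].
      apply sat_FEqV in H2. rewrite get_var_set_fresh in H2 by apply le_n.
      cbn [eval_iterm] in H2. rewrite a_int_set_same in H2. exact H2.
    + split.
      * apply IH1. now rewrite get_var_set_same.
      * apply sat_FEqV. rewrite get_var_set_fresh by apply le_n.
        cbn [eval_iterm]. now rewrite a_int_set_same.
  - cbn [inst_term]. rewrite in_vals_arith.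
    cbn [val FExs fold_right]. fold i.
    assert (Heq : forall a b : Z,
      sat J (set_int (set_int e i a) (S i) b)
        (FEqV V (IArith o (IVar i) (IVar (S i)))) <->
      get_var e V = Num (arith_fun o a b)).
    { intros a b. rewrite sat_FEqV, !get_var_set_fresh by (unfold i; lia).
      cbn [eval_iterm]. rewrite a_int_set_same, a_int_set_other by lia.
      rewrite a_int_set_same. reflexivity. }
    split; intros (a & b & H); exists a, b.
    + apply sat_val_pair in H; auto. now rewrite Heq in H.
    + apply sat_val_pair; auto. now rewrite Heq.
  - cbn [inst_term]. rewrite in_vals_div. cbn [val FExs fold_right]. fold i.
    split.
    + intros (a & b & c & H). apply sat_val_triple in H; auto.
      destruct H as (H1 & H2 & H). apply sat_val_div_matrix in H.
      destruct (set_int3_vars e V a b c) as (_ & _ & _ & Hc).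
      cbn [eval_iterm] in H. unfold i in H. rewrite Hc in H.
      destruct H as (Hl & Hr & H).
      destruct (quot_characterization _ _ _ Hl Hr) as (Hb & Hp & Hn).
      exists a, b. do 3 (split; [assumption |]).
      destruct H as [[Hs HV] | [Hs HV]]; rewrite HV;
        [rewrite (Hp Hs) | rewrite (Hn Hs)]; reflexivity.
    + intros (a & b & H1 & H2 & Hb & HV).
      (* [K] must be the quotient of the absolute values; the sign is put back by the disjunction in
         [val_div_matrix]. *)
      exists a, b, (Z.quot (Z.abs a) (Z.abs b)).
      apply sat_val_triple; auto. do 2 (split; [assumption |]).
      apply sat_val_div_matrix.
      destruct (set_int3_vars e V a b (Z.quot (Z.abs a) (Z.abs b)))
        as (_ & _ & _ & Hc).
      cbn [eval_iterm]. unfold i. rewrite Hc.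
      destruct (quot_abs_bounds a b Hb) as [Hl Hr].
      destruct (quot_characterization _ _ _ Hl Hr) as (_ & Hp & Hn).
      do 2 (split; [assumption |]). rewrite HV.
      destruct (Z_lt_ge_dec (a * b) 0) as [Hs | Hs]; [right | left];
        (split; [exact Hs |]); f_equal; [rewrite (Hn Hs) | rewrite (Hp Hs)];
        reflexivity.
  - cbn [inst_term]. rewrite in_vals_mod. cbn [val FExs fold_right]. fold i.
    split.
    + intros (a & b & c & H). apply sat_val_triple in H; auto.
      destruct H as (H1 & H2 & H). apply sat_val_div_matrix in H.
      destruct (set_int3_vars e V a b c) as (_ & Ha & Hb & Hc).
      cbn [eval_iterm] in H. unfold i in H. rewrite Ha, Hb, Hc in H.
      destruct H as (Hl & Hr & H).
      destruct (quot_characterization _ _ _ Hl Hr) as (Hb0 & Hp & Hn).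
      exists a, b. do 3 (split; [assumption |]).
      (* When the signs differ the quotient is [0 - c], so the remainder [a - b * Z.quot a b]
         becomes [a + c * b], the second value offered by the matrix. *)
      destruct H as [[Hs HV] | [Hs HV]]; rewrite HV;
        [rewrite (Hp Hs) | rewrite (Hn Hs)]; cbn; f_equal; ring.
    + intros (a & b & H1 & H2 & Hb0 & HV).
      exists a, b, (Z.quot (Z.abs a) (Z.abs b)).
      apply sat_val_triple; auto. do 2 (split; [assumption |]).
      apply sat_val_div_matrix.
      destruct (set_int3_vars e V a b (Z.quot (Z.abs a) (Z.abs b)))
        as (_ & Ha & Hb & Hc).
      cbn [eval_iterm]. unfold i. rewrite Ha, Hb, Hc.
      destruct (quot_abs_bounds a b Hb0) as [Hl Hr].
      destruct (quot_characterization _ _ _ Hl Hr) as (_ & Hp & Hn).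
      do 2 (split; [assumption |]). rewrite HV.
      destruct (Z_lt_ge_dec (a * b) 0) as [Hs | Hs]; [right | left];
        (split; [exact Hs |]); f_equal; [rewrite (Hn Hs) | rewrite (Hp Hs)];
        cbn; ring.
  - cbn [inst_term]. rewrite in_vals_interval. cbn [val FExs fold_right]. fold i.
    assert (Heq : forall a b c : Z,
      sat J (set_int3 e i a b c)
        (FAnd (FCmp CLe (GInt (IVar i)) (GInt (IVar (S (S i)))))
           (FAnd (FCmp CLe (GInt (IVar (S (S i)))) (GInt (IVar (S i))))
              (FEqV V (IVar (S (S i)))))) <->
      (a <= c)%Z /\ (c <= b)%Z /\ get_var e V = Num c).
    { intros a b c. destruct (set_int3_vars e V a b c) as (HV & Ha & Hb & Hc).
      fold i in HV, Ha, Hb, Hc. cbn [sat]. rewrite sat_FEqV, HV.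
      cbn [eval_gterm eval_iterm]. change (reduct0 J) with M. rewrite Ha, Hb, Hc.
      cbn [reduct0 J M std_interp i_cmp Defs.incl].
      now rewrite !cmpb_le_num. }
    split; intros (a & b & c & H); exists a, b, c.
    + apply sat_val_triple in H; auto. now rewrite Heq in H.
    + apply sat_val_triple; auto. now rewrite Heq.
Qed.

(** * Blocks of program variables and the translation of bodies *)

Lemma sat_val_tuple (ts : list pterm) (Vs : list var) (e : assignment M) :
  length ts = length Vs ->
  sat J e (val_tuple ts Vs) <->
  List.In (map (get_var e) Vs) (vals_tuple (map (inst_term (a_gen e)) ts)).
Proof.
  revert Vs. induction ts as [|t ts IH]; intros [|V Vs] H; try discriminate H.
  - simpl. tauto.
  - cbn [map]. rewrite in_vals_tuple_cons, <- (sat_val t V e), <- IH by now injection H.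
    reflexivity.
Qed.

(** Writes [r] into the variables with indices [m], [m + 1], and so on. The default of [nth] is the
    old value, so variables beyond the end of [r] are unchanged as well. *)
Definition upd (e : assignment M) (m : nat) (r : list precomp) : assignment M :=
  @Assignment M
    (fun v => if v <? m then a_gen e v else nth (v - m) r (a_gen e v)) (a_int e).

Lemma upd_below (e : assignment M) (m : nat) (r : list precomp) (v : pvar) :
  v < m -> a_gen (upd e m r) v = a_gen e v.
Proof. intros H. simpl. now rewrite (proj2 (Nat.ltb_lt v m) H). Qed.

Lemma upd_block (e : assignment M) (m : nat) (r : list precomp) :
  map (get_var (upd e m r)) (pvars_from m (length r)) = r.
Proof.
  unfold pvars_from. rewrite map_map.
  apply nth_ext with (d := get_var (upd e m r) (PV 0)) (d' := Inf).
  - now rewrite length_map, length_seq.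
  - intros i Hi. rewrite length_map, length_seq in Hi.
    rewrite (map_nth (fun v => get_var (upd e m r) (PV v))), seq_nth by assumption.
    unfold get_var. simpl.
    destruct (Nat.ltb_spec (m + i) m) as [H | H]; [lia |].
    replace (m + i - m) with i by lia. now apply nth_indep.
Qed.

Lemma upd_block_below (e : assignment M) (m m' n : nat) (r : list precomp) :
  m + n <= m' ->
  map (get_var (upd e m' r)) (pvars_from m n) = map (get_var e) (pvars_from m n).
Proof.
  intros H. apply map_ext_in. intros x Hx. apply in_pvars_from in Hx.
  destruct Hx as [v [-> Hv]]. apply upd_below. lia.
Qed.

Lemma sat_FExs_block (m n : nat) (F : form) (e : assignment M) :
  sat J e (FExs (pvars_from m n) F) <->
  exists r, length r = n /\ sat J (upd e m r) F.
Proof.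
  rewrite sat_FExs. split.
  - intros [e' [[Hg Hi] H]]. exists (map (a_gen e') (List.seq m n)).
    split; [now rewrite length_map, length_seq |].
    rewrite (agree_outside_nil e' (upd e m _)); [exact H |].
    split; [intros v _ | intros k _; simpl; symmetry; apply Hi].
    + simpl. destruct (Nat.ltb_spec v m) as [Hv | Hv].
      * symmetry. apply Hg. rewrite in_pvars_from. intros [w [[= <-] Hw]]. lia.
      * destruct (Nat.lt_ge_cases v (m + n)) as [Hn | Hn].
        (* The index is in range, so the default may be exchanged for one of the form required by
           [map_nth]. *)
        -- rewrite nth_indep with (d' := a_gen e' 0)
             by (rewrite length_map, length_seq; lia).
           rewrite map_nth, seq_nth by lia. f_equal. lia.
        -- rewrite nth_overflow by (rewrite length_map, length_seq; lia).
           symmetry. apply Hg. rewrite in_pvars_from. intros [w [[= <-] Hw]]. lia.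
    + rewrite in_pvars_from. intros [w [[=] _]].
  - intros [r [<- H]]. exists (upd e m r). split; [| exact H].
    split; [intros v Hv | reflexivity]. simpl.
    destruct (Nat.ltb_spec v m) as [Hm | Hm]; [reflexivity |].
    apply nth_overflow. rewrite in_pvars_from in Hv.
    destruct (Nat.lt_ge_cases v (m + length r)); [| lia].
    destruct Hv. eauto.
Qed.

(** The block starts above the variables of [ts], so choosing values for it does not alter the
    instance of [ts]; membership in [vals_tuple] fixes the length of [r]. *)
Lemma sat_FExs_val (ts : list pterm) (m : nat) (F : form) (e : assignment M) :
  terms_bound ts <= m ->
  let Vs := pvars_from m (length ts) in
  sat J e (FExs Vs (FAnd (val_tuple ts Vs) F)) <->
  exists r, List.In r (vals_tuple (map (inst_term (a_gen e)) ts)) /\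
    sat J (upd e m r) F.
Proof.
  intros Hm Vs. unfold Vs. rewrite sat_FExs_block.
  assert (Hv : forall r, length r = length ts ->
    sat J (upd e m r) (val_tuple ts (pvars_from m (length ts))) <->
    List.In r (vals_tuple (map (inst_term (a_gen e)) ts))).
  { intros r Hr. rewrite sat_val_tuple by now rewrite length_pvars_from.
    rewrite <- Hr, upd_block.
    now rewrite (inst_terms_ext _ (a_gen e) _ m Hm) by apply upd_below. }
  split.
  - intros [r [Hr [H1 H2]]]. exists r. split; [now apply Hv | exact H2].
  - intros [r [H1 H2]].
    assert (Hr : length r = length ts)
      by now rewrite (vals_tuple_length _ _ H1), length_map.
    exists r. split; [exact Hr |]. split; [now apply Hv | exact H2].
Qed.

Lemma sat_atom_form (p : symbol) (Vs : list var) (e : assignment M) :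
  sat J e (atom_form p Vs) = I (p, map (get_var e) Vs).
Proof. unfold atom_form. cbn. now rewrite map_map. Qed.

(** [P] is the semantic counterpart of [f]: identity, negation or double negation, so that the three
    kinds of literals share one proof. *)
Lemma sat_tauB_atom (a : atom) (f : form -> form) (P : Prop -> Prop)
  (e : assignment M) :
  (forall e' F, sat J e' (f F) = P (sat J e' F)) ->
  sat J e (tauB_atom a f) <->
  exists r, List.In r (vals_tuple (aargs (inst_atom (a_gen e) a))) /\
    P (I (asym a, r)).
Proof.
  intros Hf. unfold tauB_atom. rewrite sat_FExs_val by apply le_n.
  split; intros [r [Hr H]]; exists r; (split; [exact Hr |]);
    assert (Hl := vals_tuple_length _ _ Hr);
    cbn [inst_atom aargs] in Hl; rewrite length_map in Hl;
    rewrite Hf, sat_atom_form, <- Hl, upd_block in *; exact H.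
Qed.

Lemma sat_tauB_body_elt (b : body_elt) (e : assignment M) :
  sat J e (tauB_body_elt b) <->
  psat I (tau_body_elt lt (inst_body_elt (a_gen e) b)).
Proof.
  destruct b as [a | a | a | o t1 t2]; cbn [tauB_body_elt inst_body_elt tau_body_elt].
  - rewrite (sat_tauB_atom a _ (fun P => P)) by reflexivity.
    rewrite psat_PBigOr. unfold ground_atoms. split.
    + intros [r [Hr H]]. eexists. split; [apply in_map, Hr | exact H].
    + intros [F [HF H]]. apply in_map_iff in HF. destruct HF as [r [<- Hr]]. eauto.
  - rewrite (sat_tauB_atom a _ not) by reflexivity.
    rewrite psat_PBigOr. unfold ground_atoms. rewrite map_map. split.
    + intros [r [Hr H]]. eexists. split; [apply in_map, Hr | exact H].
    + intros [F [HF H]]. apply in_map_iff in HF. destruct HF as [r [<- Hr]]. eauto.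
  - rewrite (sat_tauB_atom a _ (fun P => ~ ~ P)) by reflexivity.
    rewrite psat_PBigOr. unfold ground_atoms. rewrite map_map. split.
    + intros [r [Hr H]]. eexists. split; [apply in_map, Hr | exact H].
    + intros [F [HF H]]. apply in_map_iff in HF. destruct HF as [r [<- Hr]]. eauto.
  - set (m := terms_bound [t1; t2]).
    (* The two variables of a comparison form a block of length 2, so the block lemmas apply to
       them. *)
    change [PV m; PV (S m)] with (pvars_from m 2).
    rewrite sat_FExs_block.
    set (s := a_gen e).
    assert (Hc : forall c d,
      sat J (upd e m [c; d]) (FAnd (val t1 (PV m)) (FAnd (val t2 (PV (S m)))
        (FCmp o (var_term (PV m)) (var_term (PV (S m)))))) <->
      List.In c (vals (inst_term s t1)) /\ List.In d (vals (inst_term s t2)) /\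
      cmpb lt o c d = true).
    { intros c d. cbn [sat]. rewrite !(sat_val _ (PV _)).
      assert (H := upd_block e m [c; d]).
      cbn [pvars_from length List.seq map] in H. injection H as H1 H2.
      rewrite H1, H2.
      assert (Hs : forall t, List.In t [t1; t2] ->
        inst_term (a_gen (upd e m [c; d])) t = inst_term s t).
      { intros t Ht. apply inst_term_ext. intros x Hx. apply upd_below.
        apply term_pvars_bound in Hx. apply term_bound_le in Ht. unfold m. lia. }
      rewrite (Hs t1), (Hs t2) by (simpl; auto).
      unfold get_var in H1, H2. change (reduct0 J) with M. rewrite H1, H2.
      reflexivity. }
    transitivity (exists c d, List.In c (vals (inst_term s t1)) /\
      List.In d (vals (inst_term s t2)) /\ cmpb lt o c d = true).
    + split.
      * intros [r [Hr H]]. destruct r as [|c [|d [|]]]; try discriminate Hr.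
        exists c, d. now apply Hc.
      * intros (c & d & H). exists [c; d]. split; [reflexivity |]. now apply Hc.
    + destruct (existsb _ _) eqn:E.
      * split; [simpl; tauto |]. intros _.
        apply existsb_exists in E. destruct E as [c [H1 E]].
        apply existsb_exists in E. destruct E as [d [H2 E]]. eauto.
      * split; [| intros []]. intros (c & d & H1 & H2 & H).
        rewrite <- not_true_iff_false in E. apply E.
        apply existsb_exists. exists c. split; [assumption |].
        apply existsb_exists. eauto.
Qed.

Lemma sat_tauB_body (B : list body_elt) (e : assignment M) :
  sat J e (tauB_body B) <->
  psat I (tau_body lt (map (inst_body_elt (a_gen e)) B)).
Proof.
  unfold tauB_body, tau_body. rewrite sat_FBigAnd, psat_PBigAnd, map_map.
  split; intros H F HF; apply in_map_iff in HF; destruct HF as [b [<- Hb]].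
  - apply sat_tauB_body_elt, H. now apply in_map.
  - apply sat_tauB_body_elt, H.
    exact (in_map (fun b => tau_body_elt lt (inst_body_elt (a_gen e) b)) _ _ Hb).
Qed.

(** The last conjunct is the classical reading of the double negation added for choice rules; for a
    basic rule its premise is false. *)
Lemma sat_Form (R : rule) (h : atom) (X : list var) (e : assignment M) :
  head_lit R = Some h -> length (aargs h) = length X ->
  sat J e (Form R X) <->
  List.In (map (get_var e) X) (vals_tuple (aargs (inst_atom (a_gen e) h))) /\
  psat I (tau_body lt (body (inst_rule (a_gen e) R))) /\
  (Defs.head R = Choice h -> I (asym h, map (get_var e) X)).
Proof.
  unfold head_lit, Form. intros Hh HX.
  destruct (Defs.head R) as [a | a |]; inversion Hh; subst a;
    cbn [sat FNeg]; rewrite ?sat_atom_form, sat_val_tuple, sat_tauB_body by assumption.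
  - cbn. intuition discriminate.
  - cbn. split.
    + intros [[H1 H2] H3]. split; [exact H1 |]. split; [exact H2 |].
      intros _. now apply NNPP.
    + intros (H1 & H2 & H3). split; [auto |]. intros H. apply H. now apply H3.
Qed.

(** * Semantic content of the conjuncts of the ordered completion *)

Variable Pi : program.

(** The block [Z] starts after the head variables, which themselves start at [program_bound Pi].
    Writing [z] into it therefore disturbs neither the head tuple nor the instance of [a]. *)
Lemma sat_prec_conjunct (p : pred) (a : atom) (e : assignment M) :
  terms_bound (aargs a) <= program_bound Pi ->
  sat J e (prec_conjunct Pi p (head_vars Pi p) a) <->
  exists z, List.In z (vals_tuple (aargs (inst_atom (a_gen e) a))) /\
    I (asym a, z) /\
    prec (asym a) (fst p) z (map (get_var e) (head_vars Pi p)).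
Proof.
  intros Ha. unfold prec_conjunct. rewrite sat_FExs_val by lia.
  assert (H : forall z, length z = length (aargs a) ->
    let e' := upd e (program_bound Pi + snd p) z in
    let Z := pvars_from (program_bound Pi + snd p) (length (aargs a)) in
    sat J e' (FAnd (atom_form (asym a) Z)
      (FPrec (asym a) (fst p) (map var_term Z) (map var_term (head_vars Pi p))))
    <-> I (asym a, z) /\
        prec (asym a) (fst p) z (map (get_var e) (head_vars Pi p))).
  { intros z Hz e' Z. cbn [sat]. rewrite sat_atom_form, !map_map.
    change (I (asym a, map (get_var e') Z) /\
      prec (asym a) (fst p) (map (get_var e') Z) (map (get_var e') (head_vars Pi p))
      <-> I (asym a, z) /\
          prec (asym a) (fst p) z (map (get_var e) (head_vars Pi p))).
    unfold Z, e'. rewrite <- Hz, upd_block. unfold head_vars.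
    now rewrite upd_block_below by lia. }
  split; intros [z [Hz Hs]]; exists z; (split; [exact Hz |]);
    apply H; trivial;
    rewrite (vals_tuple_length _ _ Hz); cbn [inst_atom aargs];
    now rewrite length_map.
Qed.

Lemma length_head_vars (p : pred) : length (head_vars Pi p) = snd p.
Proof. apply length_pvars_from. Qed.

(** Head variables lie above every variable of the program, so the instance given by [s] and the
    head tuple [r] can be prescribed independently. *)
Lemma exists_head_assignment (R : rule) (s : pvar -> precomp) (p : pred)
  (r : list precomp) :
  List.In R (rules Pi) -> length r = snd p ->
  exists e : assignment M, inst_rule (a_gen e) R = inst_rule s R /\
    map (get_var e) (head_vars Pi p) = r.
Proof.
  intros HR Hr.
  exists (upd (@Assignment M s (fun _ => 0%Z))
            (program_bound Pi) r).
  split.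
  - apply inst_rule_ext. intros t x Ht Hx. apply upd_below.
    apply term_pvars_bound in Hx.
    pose proof (program_bound_spec Pi R t HR Ht). lia.
  - unfold head_vars. rewrite <- Hr. apply upd_block.
Qed.

Lemma is_model_Cons :
  is_model J (Cons Pi) <->
  forall R, List.In R (rules Pi) -> Defs.head R = Constraint ->
  forall s, ~ psat I (tau_body lt (body (inst_rule s R))).
Proof.
  unfold Cons. rewrite is_model_FBigAnd_map. split.
  - intros H R HR Hc s HB.
    assert (HR' : List.In R (filter is_constraint (rules Pi))).
    { apply filter_In. split; [assumption |]. unfold is_constraint. now rewrite Hc. }
    specialize (H R HR'). cbv zeta in H. rewrite is_model_FAlls in H.
    apply (H (@Assignment M s (fun _ => 0%Z))).
    now apply sat_tauB_body.
  - intros H R HR. apply filter_In in HR. destruct HR as [HR Hc].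
    unfold is_constraint in Hc.
    apply is_model_FAlls. intros e HB. apply sat_tauB_body in HB.
    apply (H R HR) with (a_gen e); [| exact HB].
    now destruct (Defs.head R).
Qed.

Lemma agree_outside_head_vars (p : pred) (R : rule) (e e' : assignment M) :
  agree_outside (other_free_vars R (head_vars Pi p)) e e' ->
  map (get_var e') (head_vars Pi p) = map (get_var e) (head_vars Pi p).
Proof.
  intros H. apply map_ext_in. intros x Hx.
  apply (agree_outside_get _ _ _ _ H).
  unfold other_free_vars. rewrite in_remove_vars. tauto.
Qed.

(** For a choice rule [Form] already contains the double negation of the conclusion, so the
    implication is classically trivial; hence the escape [Choice h]. *)
Lemma is_model_Comp_left (p : pred) :
  is_model J (Comp_left Pi p) <->
  forall R h s r, List.In R (rules Pi) -> head_lit R = Some h -> atom_pred h = p ->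
    List.In r (vals_tuple (aargs (inst_atom s h))) ->
    psat I (tau_body lt (body (inst_rule s R))) ->
    Defs.head R = Choice h \/ I (asym h, r).
Proof.
  unfold Comp_left. cbv zeta. rewrite is_model_FAlls. split.
  - intros H R h s r HR Hh Hp Hr HB.
    assert (Hl : length r = snd p).
    { rewrite (vals_tuple_length _ _ Hr). cbn [inst_atom aargs].
      rewrite length_map. now subst p. }
    destruct (exists_head_assignment R s p r HR Hl) as [e [Hs HX]].
    specialize (H e). cbn [sat] in H. rewrite sat_atom_form, HX in H.
    destruct (classic (Defs.head R = Choice h)) as [Hc | Hc]; [now left | right].
    replace (asym h) with (fst p) by now subst p.
    apply H. apply sat_FBigOr. eexists. split.
    + apply in_map, in_rules_for. eauto.
    + apply sat_FExs. exists e. split; [apply agree_outside_refl |].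
      apply (sat_Form R h); [assumption | rewrite length_head_vars; now subst p |].
      rewrite HX, Hs. split; [| split; [assumption | tauto]].
      (* The two substitutions are only known to give the same rule instance; equality of the
         instantiated heads is read off from it. *)
      assert (Hh' : Some (inst_atom (a_gen e) h) = Some (inst_atom s h)).
      { change (option_map (inst_atom (a_gen e)) (Some h) =
                option_map (inst_atom s) (Some h)).
        now rewrite <- Hh, <- !head_lit_inst, Hs. }
      injection Hh' as Hh'. unfold inst_atom. cbn [aargs].
      now rewrite Hh'.
  - intros H e. cbn [sat]. rewrite sat_atom_form. intros HF.
    apply sat_FBigOr in HF. destruct HF as [F [HF HS]].
    apply in_map_iff in HF. destruct HF as [R [<- HR]].
    apply in_rules_for in HR. destruct HR as [HR [h [Hh Hp]]].
    apply sat_FExs in HS. destruct HS as [e' [He HS]].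
    rewrite <- (agree_outside_head_vars p R e e' He).
    apply (sat_Form R h) in HS;
      [| assumption | rewrite length_head_vars; now subst p].
    destruct HS as (H1 & H2 & H3). subst p. cbn [fst atom_pred].
    destruct (H R h (a_gen e') _ HR Hh eq_refl H1 H2); auto.
Qed.

(** The order enters as the set in which positive body atoms are evaluated: the atoms of [I] below
    the head. The extra conjunct of a choice rule is met because the head atom is assumed to be in
    [I]. *)
Lemma is_model_OComp_right (p : pred) :
  is_model J (OComp_right Pi p) <->
  forall r, length r = snd p -> I (fst p, r) ->
    supported lt Pi I
      (fun qa => I qa /\ prec (fst qa) (fst p) (snd qa) r) (fst p, r).
Proof.
  unfold OComp_right. cbv zeta. rewrite is_model_FAlls. split.
  - intros H r Hl Hr.
    set (e := upd (@Assignment M (fun _ => Inf) (fun _ => 0%Z))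
                (program_bound Pi) r).
    assert (HX : map (get_var e) (head_vars Pi p) = r).
    { unfold head_vars. rewrite <- Hl. apply upd_block. }
    specialize (H e). cbn [sat] in H. rewrite sat_atom_form, HX in H.
    specialize (H Hr). apply sat_FBigOr in H. destruct H as [F [HF HS]].
    apply in_map_iff in HF. destruct HF as [R [<- HR]].
    apply in_rules_for in HR. destruct HR as [HR [h [Hh Hp]]].
    apply sat_FExs in HS. destruct HS as [e' [He [HS HP]]].
    rewrite <- (agree_outside_head_vars p R e e' He) in HX.
    apply (sat_Form R h) in HS;
      [| assumption | rewrite length_head_vars; now subst p].
    rewrite HX in HS. destruct HS as (H1 & H2 & _).
    exists R, (a_gen e'), (inst_atom (a_gen e') h).
    split; [assumption |]. split; [now rewrite head_lit_inst, Hh |].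
    split; [now subst p |]. split; [exact H1 |]. split; [exact H2 |].
    intros a' Ha'. rewrite body_pos_inst in Ha'.
    apply in_map_iff in Ha'. destruct Ha' as [a [<- Ha]].
    rewrite sat_FBigAnd in HP.
    specialize (HP _ (in_map _ _ _ Ha)).
    apply sat_prec_conjunct in HP; [| now apply body_pos_bound with R].
    rewrite HX in HP. exact HP.
  - intros H e. cbn [sat]. rewrite sat_atom_form. intros Hr.
    set (r := map (get_var e) (head_vars Pi p)) in *.
    assert (Hl : length r = snd p).
    { unfold r. now rewrite length_map, length_head_vars. }
    destruct (H r Hl Hr) as (R & s & h' & HR & Hh' & Hp & H1 & H2 & H3).
    cbn [fst snd] in Hp, H1.
    assert (Hh := head_lit_inst s R). rewrite Hh' in Hh.
    destruct (head_lit R) as [h |] eqn:Eh; [| discriminate Hh].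
    injection Hh as ->.
    (* [supported] compares predicate symbols only; the arity is recovered from the length of the
       tuple [r]. *)
    assert (Ep : atom_pred h = p).
    { destruct p as [p n]. unfold atom_pred. cbn [fst snd] in *. rewrite Hp.
      f_equal. rewrite <- Hl, (vals_tuple_length _ _ H1). cbn [inst_atom aargs].
      now rewrite length_map. }
    assert (HX : length (aargs h) = length (head_vars Pi p)).
    { rewrite length_head_vars. now subst p. }
    apply sat_FBigOr. eexists. split; [apply in_map, in_rules_for; eauto |].
    apply sat_FExs.
    set (Y := other_free_vars R (head_vars Pi p)).
    (* The quantified variables [Y] take their values from [s], all others from [e]. Since [Y] omits
       the head variables and contains all variables of the rule, both the head tuple and the
       instance come out right. *)
    set (e' := @Assignment M
      (fun v => if in_dec var_eq_dec (PV v) Y then s v else a_gen e v) (a_int e)).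
    assert (He : agree_outside Y e e').
    { split; [intros v Hv | reflexivity]. simpl.
      destruct (in_dec var_eq_dec (PV v) Y); [contradiction | reflexivity]. }
    exists e'. split; [exact He |].
    assert (Hs : inst_rule (a_gen e') R = inst_rule s R).
    { apply inst_rule_ext. intros t x Ht Hx. simpl.
      destruct (in_dec var_eq_dec (PV x) Y) as [_ | HY]; [reflexivity |].
      destruct HY. apply in_remove_vars. split.
      - apply nodup_In. now apply free_occs_Form with h t.
      - unfold head_vars. rewrite in_pvars_from. intros [v [[= <-] Hv]].
        apply term_pvars_bound in Hx.
        pose proof (program_bound_spec Pi R t HR Ht). lia. }
    assert (HXe := agree_outside_head_vars p R e e' He). fold r in HXe.
    split.
    + apply (sat_Form R h); [assumption | assumption |]. rewrite HXe, Hs.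
      split; [| split; [exact H2 | intros _; now rewrite <- Ep in Hr]].
      assert (Ee := head_lit_inst (a_gen e') R).
      rewrite Hs, Hh', Eh in Ee. cbn [option_map] in Ee.
      assert (Ea : aargs (inst_atom s h) = aargs (inst_atom (a_gen e') h))
        by congruence.
      now rewrite <- Ea.
    + apply sat_FBigAnd. intros F HF.
      apply in_map_iff in HF. destruct HF as [a [<- Ha]].
      apply sat_prec_conjunct; [now apply body_pos_bound with R |].
      rewrite HXe. rewrite <- Hs in H3.
      apply (H3 (inst_atom (a_gen e') a)). rewrite body_pos_inst.
      now apply in_map.
Qed.

Lemma is_model_Irref :
  is_model J (Irref Pi) <->
  forall p r, List.In p (preds Pi) -> length r = snd p ->
    ~ prec (fst p) (fst p) r r.
Proof.
  unfold Irref. rewrite is_model_FBigAnd_map. split.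
  - intros H p r Hp Hl Hr. specialize (H p Hp). cbv zeta in H.
    rewrite is_model_FAlls in H.
    set (e := upd (@Assignment M (fun _ => Inf) (fun _ => 0%Z)) 0 r).
    apply (H e). cbn [sat]. rewrite map_map.
    change (prec (fst p) (fst p) (map (get_var e) (pvars_from 0 (snd p)))
              (map (get_var e) (pvars_from 0 (snd p)))).
    rewrite <- Hl. unfold e. now rewrite upd_block.
  - intros H p Hp. apply is_model_FAlls. intros e. cbn [FNeg sat]. rewrite map_map.
    apply H; [assumption |]. now rewrite length_map, length_pvars_from.
Qed.

Lemma is_model_Trans :
  is_model J (Trans Pi) <->
  forall p q r x y z, List.In p (preds Pi) -> List.In q (preds Pi) ->
    List.In r (preds Pi) ->
    length x = snd p -> length y = snd q -> length z = snd r ->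
    prec (fst p) (fst q) x y -> prec (fst q) (fst r) y z ->
    prec (fst p) (fst r) x z.
Proof.
  assert (HT : is_model J (Trans Pi) <->
    forall p q r, List.In p (preds Pi) -> List.In q (preds Pi) ->
      List.In r (preds Pi) -> is_model J (Trans_for p q r)).
  { unfold Trans. split.
    - intros H p q r Hp Hq Hr e.
      apply (proj1 (sat_FBigAnd _ _) (H e)).
      apply in_flat_map. exists p. split; [assumption |].
      apply in_flat_map. exists q. split; [assumption |]. now apply in_map.
    - intros H e. apply sat_FBigAnd. intros F HF.
      apply in_flat_map in HF. destruct HF as [p [Hp HF]].
      apply in_flat_map in HF. destruct HF as [q [Hq HF]].
      apply in_map_iff in HF. destruct HF as [r [<- Hr]]. now apply H. }
  rewrite HT. unfold Trans_for. split.
  - intros H p q r x y z Hp Hq Hr Hx Hy Hz Hxy Hyz.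
    specialize (H p q r Hp Hq Hr). cbv zeta in H. rewrite is_model_FAlls in H.
    set (e0 := @Assignment M (fun _ => Inf) (fun _ => 0%Z)).
    (* The blocks are written in increasing order: each [upd] leaves everything below its start
       intact, so earlier blocks keep their values. *)
    set (e := upd (upd (upd e0 0 x) (snd p) y) (snd p + snd q) z).
    specialize (H e). cbn [sat] in H. rewrite !map_map in H.
    set (X := pvars_from 0 (snd p)) in H.
    set (Y := pvars_from (snd p) (snd q)) in H.
    set (Z := pvars_from (snd p + snd q) (snd r)) in H.
    change (prec (fst p) (fst q) (map (get_var e) X) (map (get_var e) Y) /\
      prec (fst q) (fst r) (map (get_var e) Y) (map (get_var e) Z) ->
      prec (fst p) (fst r) (map (get_var e) X) (map (get_var e) Z)) in H.
    assert (Ex : map (get_var e) X = x).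
    { unfold e, X. rewrite !upd_block_below, <- Hx by lia. apply upd_block. }
    assert (Ey : map (get_var e) Y = y).
    { unfold e, Y. rewrite upd_block_below, <- Hy by lia. apply upd_block. }
    assert (Ez : map (get_var e) Z = z).
    { unfold e, Z. rewrite <- Hz. apply upd_block. }
    rewrite Ex, Ey, Ez in H. auto.
  - intros H p q r Hp Hq Hr. cbv zeta. apply is_model_FAlls. intros e. cbn [sat].
    rewrite !map_map. intros [Hxy Hyz].
    eapply (H p q r); try eassumption; now rewrite length_map, length_pvars_from.
Qed.

(** Constraints correspond to [Cons] and basic rules to [Comp_left], while instances of choice rules
    are classical tautologies. *)
Lemma is_model_tau :
  (forall F, tau lt Pi F -> psat I F) <->
  is_model J (Cons Pi) /\
  forall p, List.In p (preds Pi) -> is_model J (Comp_left Pi p).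
Proof.
  rewrite is_model_Cons. split.
  - intros H. split.
    + intros R HR Hc s.
      assert (H1 : psat I (tau_rule lt (inst_rule s R)))
        by (apply H; exists R, s; auto).
      unfold tau_rule in H1. simpl Defs.head in H1. now rewrite Hc in H1.
    + intros p _. apply is_model_Comp_left.
      intros R h s r HR Hh Hp Hr HB.
      assert (H1 : psat I (tau_rule lt (inst_rule s R)))
        by (apply H; exists R, s; auto).
      unfold head_lit in Hh. unfold tau_rule in H1. simpl Defs.head in H1.
      destruct (Defs.head R) as [h' | h' |]; inversion Hh; subst h'; [right | now left].
      cbn [inst_head psat] in H1. specialize (H1 HB).
      rewrite psat_PBigAnd in H1.
      exact (H1 _ (in_map (fun r => PAtom (asym h, r)) _ _ Hr)).
  - intros [Hc Hl] F (R & s & HR & ->).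
    unfold tau_rule. simpl Defs.head.
    destruct (Defs.head R) as [h | h |] eqn:Eh; cbn [inst_head psat].
    + intros HB. apply psat_PBigAnd. intros F HF.
      apply in_map_iff in HF. destruct HF as [r [<- Hr]].
      assert (Hh : head_lit R = Some h) by (unfold head_lit; now rewrite Eh).
      assert (HC := proj1 (is_model_Comp_left (atom_pred h))
        (Hl _ (head_pred_in_preds Pi R h HR Hh)) R h s r HR Hh eq_refl Hr HB).
      destruct HC as [HC | HC]; [congruence | exact HC].
    + intros _. apply psat_PBigAnd. intros F HF.
      apply in_map_iff in HF. destruct HF as [F' [<- _]]. apply classic.
    + exact (Hc R HR Eh s).
Qed.

Lemma is_model_OC :
  is_model J (OC Pi) <->
  (forall F, tau lt Pi F -> psat I F) /\
  is_model J (Irref Pi) /\ is_model J (Trans Pi) /\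
  forall p, List.In p (preds Pi) -> is_model J (OComp_right Pi p).
Proof.
  unfold OC. rewrite !is_model_FAnd, is_model_FBigAnd_map, is_model_tau.
  setoid_rewrite is_model_FAnd. firstorder.
Qed.

End Standard.

(** * Derivation stages *)

(** The intersection with [I] at every step is what lets choice rules act: they derive exactly those
    supported heads that [I] has chosen. *)
Fixpoint stage (lt : precomp -> precomp -> bool) (Pi : program)
  (I : Ensemble patom) (n : nat) : Ensemble patom :=
  match n with
  | 0 => Empty_set patom
  | S m => fun pa => I pa /\ supported lt Pi I (stage lt Pi I m) pa
  end.

Section Stages.
Variable lt : precomp -> precomp -> bool.
Variable Pi : program.
Variable I : Ensemble patom.

(** Monotone because [X] occurs only in the positive part of the body; negated literals are
    evaluated in the fixed [I]. *)
Lemma supported_mono (X X' : Ensemble patom) (pa : patom) :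
  Included patom X X' -> supported lt Pi I X pa -> supported lt Pi I X' pa.
Proof.
  intros HX (R & s & h & HR & Hh & Hp & H1 & H2 & H3).
  exists R, s, h. repeat (split; [assumption |]).
  intros a Ha. destruct (H3 a Ha) as [r [Hr Hx]]. exists r.
  split; [assumption | now apply HX].
Qed.

Lemma stage_le (m n : nat) :
  m <= n -> Included patom (stage lt Pi I m) (stage lt Pi I n).
Proof.
  assert (HS : forall k, Included patom (stage lt Pi I k) (stage lt Pi I (S k))).
  { induction k as [|k IH]; [intros pa [] |].
    intros pa [Ha Hs]. split; [exact Ha |]. exact (supported_mono _ _ pa IH Hs). }
  induction 1 as [|n _ IH]; [intros pa H; exact H |].
  intros pa H. now apply HS, IH.
Qed.

(* The body of a rule is finite, so its positive part is supported already at
   some finite stage. *)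
Lemma supported_stage_union (pa : patom) :
  supported lt Pi I (fun qa => exists n, stage lt Pi I n qa) pa ->
  exists n, supported lt Pi I (stage lt Pi I n) pa.
Proof.
  intros (R & s & h & HR & Hh & Hp & H1 & H2 & H3).
  assert (Hn : exists n, pos_supported (stage lt Pi I n) (inst_rule s R)).
  { unfold pos_supported in *. induction (body_pos (inst_rule s R)) as [|a l IH].
    - exists 0. intros a [].
    - destruct IH as [n Hn]; [intros b Hb; apply H3; now right |].
      destruct (H3 a (or_introl eq_refl)) as [r [Hr [m Hm]]].
      exists (Nat.max m n). intros b [<- | Hb].
      + exists r. split; [assumption |].
        exact (stage_le m _ (Nat.le_max_l m n) _ Hm).
      + destruct (Hn b Hb) as [r' [Hr' Hm']]. exists r'. split; [assumption |].
        exact (stage_le n _ (Nat.le_max_r m n) _ Hm'). }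
  destruct Hn as [n Hn]. exists n, R, s, h. auto 10.
Qed.

(** The union of the stages is included in [I] and, by [supported_stage_union], closed, so the
    minimality of [I] applies to it. *)
Lemma stable_model_stage (pa : patom) :
  stable_model lt Pi I -> I pa -> exists n, stage lt Pi I n pa.
Proof.
  intros Hst Ha. apply stable_model_iff in Hst. destruct Hst as [_ Hmin].
  apply (Hmin (fun qa => exists n, stage lt Pi I n qa)); [| | exact Ha].
  - intros qa [[|n] Hn]; [destruct Hn | apply Hn].
  - intros qa Hq Hs. apply supported_stage_union in Hs.
    destruct Hs as [n Hn]. exists (S n). now split.
Qed.

End Stages.

(** Order properties are required on [D] alone, because [Irref] and [Trans] speak only about
    predicates of the program. The induction runs over the finite superset [E], so no finiteness of
    [D] has to be maintained. *)
Lemma finite_minimal {A : Type} (lt : A -> A -> Prop) (E D : Ensemble A) :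
  Finite A E -> Included A D E ->
  (forall a, D a -> ~ lt a a) ->
  (forall a b c, D a -> D b -> D c -> lt a b -> lt b c -> lt a c) ->
  Inhabited A D ->
  exists m, D m /\ forall a, D a -> ~ lt a m.
Proof.
  intros HE. revert D. induction HE as [|E HE IH x Hx]; intros D HD Hirr Htr Hin.
  - destruct Hin as [a Ha]. destruct (HD a Ha).
  - assert (Hcase : forall a, D a -> E a \/ a = x).
    { intros a Ha. destruct (HD a Ha) as [b Hb | b Hb];
        [now left | right; now destruct Hb]. }
    set (D' := fun a => D a /\ E a).
    destruct (classic (Inhabited A D')) as [HDi | HDi].
    + destruct (IH D') as [m [[Hm _] Hmin]]; auto.
      * now intros a [_ Ha].
      * now intros a [Ha _]; apply Hirr.
      * intros a b c [Ha _] [Hb _] [Hc _]. now apply Htr.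
      (* If the added point [x] lies below the minimum [m] of the rest, it becomes the new minimum:
         anything below [x] would be below [m] by transitivity. *)
      * destruct (classic (D x /\ lt x m)) as [[HDx Hxm] | Hxm].
        -- exists x. split; [exact HDx |]. intros a Ha Hax.
           destruct (Hcase a Ha) as [HEa | ->]; [| now apply (Hirr x)].
           apply (Hmin a (conj Ha HEa)). exact (Htr a x m Ha HDx Hm Hax Hxm).
        -- exists m. split; [exact Hm |]. intros a Ha Ham.
           destruct (Hcase a Ha) as [HEa | ->]; [| tauto].
           now apply (Hmin a).
    + destruct Hin as [y Hy]. exists y. split; [exact Hy |]. intros a Ha.
      assert (Hall : forall b, D b -> b = x).
      { intros b Hb. destruct (Hcase b Hb) as [HEb | ->]; [| reflexivity].
        destruct HDi. exists b. now split. }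
      rewrite (Hall a Ha), (Hall y Hy). apply Hirr. now rewrite <- (Hall y Hy).
Qed.

(** [HL] says that [I] consists of atoms over the predicates of [Pi]. The formula [OC] constrains
    only these, so an atom over a foreign predicate could belong to [I] without any support. *)
Theorem mainTheorem2
  (lt : precomp -> precomp -> bool) (Hlt : precomp_order lt)
  (Pi : program) (I : Ensemble patom) (HI : Finite patom I)
  (HL : forall a : patom, I a -> List.In (patom_pred a) (preds Pi)) :
  stable_model lt Pi I <->
  exists J : interp, reduct0 J = std_interp lt I /\ is_model J (OC Pi).
Proof.
  split.
  - intros Hst.
    exists (Interp (std_interp lt I) (fun p q x y =>
      exists n, stage lt Pi I n (p, x) /\ ~ stage lt Pi I n (q, y))).
    split; [reflexivity |]. apply is_model_OC; [assumption |].
    split; [now apply stable_model_iff in Hst |].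
    split; [apply is_model_Irref | split; [apply is_model_Trans |]]; auto.
    + intros p r _ _ [n Hn]. tauto.
    + intros p q r x y z _ _ _ _ _ _ [m [Hmx Hmy]] [n [Hny Hnz]].
      (* The stage separating [y] from [z] also separates [x] from [z]: if [n <= m], then [y] would
         already be in stage [m], contrary to [Hmy]. *)
      exists n. split; [| exact Hnz].
      destruct (Nat.le_ge_cases m n) as [H | H].
      * exact (stage_le lt Pi I m n H _ Hmx).
      * destruct Hmy. exact (stage_le lt Pi I n m H _ Hny).
    + intros p _. apply is_model_OComp_right; [assumption |].
      intros r _ Hr.
      destruct (stable_model_stage lt Pi I (fst p, r) Hst Hr) as [n Hn].
      (* Descends to the first stage containing the atom. It is in stage [S n] but not in stage [n],
         so its supporting atoms, all in stage [n], precede it with [n] as witness. *)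
      induction n as [|n IH]; [destruct Hn |].
      destruct (classic (stage lt Pi I n (fst p, r))) as [H | H]; [now apply IH |].
      destruct Hn as [_ Hn]. apply supported_mono with (2 := Hn).
      intros [q z] Hq. split.
      * destruct n; [destruct Hq | apply Hq].
      * exists n. now split.
  - intros [[M prec] [HM HJ]]. simpl in HM. subst M.
    apply is_model_OC in HJ; [| assumption].
    destruct HJ as (Hm & Hirr & Htr & Hoc).
    apply stable_model_iff. split; [exact Hm |].
    intros I' HI' Hcl pa Ha. apply NNPP. intros Hna.
    destruct (finite_minimal (fun a b => prec (fst a) (fst b) (snd a) (snd b))
      I (fun a => I a /\ ~ I' a) HI) as [[p r] [[Hp Hnp] Hmin]].
    + now intros a [H _].
    + intros a [Hai _]. apply (proj1 (is_model_Irref _ _ _ _) Hirr (patom_pred a));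
        [now apply HL | reflexivity].
    + intros a b c [Hai _] [Hbi _] [Hci _].
      apply (proj1 (is_model_Trans _ _ _ _) Htr
        (patom_pred a) (patom_pred b) (patom_pred c)); auto.
    + now exists pa.
    + apply Hnp, Hcl; [exact Hp |].
      (* By [HL] the predicate of the minimal missing atom belongs to the program, so its ordered
         completion is available. A supporting atom outside [I'] would contradict [Hmin]. *)
      assert (Hs := proj1 (is_model_OComp_right _ _ _ Hlt Pi (p, length r))
        (Hoc _ (HL _ Hp)) r eq_refl Hp).
      apply supported_mono with (2 := Hs). intros a [Hai Hlta].
      apply NNPP. intros Hnai. exact (Hmin a (conj Hai Hnai) Hlta).
Qed.
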